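(* Let $V$ be a finite nonempty set with $|V|=n+1$, let $T=T_V$, and let $0\le k\le n$. Then the degrees of freedom $\Psi_F$, where $F$ ranges over all flags on $V$ with $n-k+1$ parts, form the basis dual to the blow-up Whitney $k$-forms $\psi_F$. That is, for all flags $F,F'$ on $V$, each with $n-k+1$ parts, the quantity $\Psi_{F'}(\psi_F)$ is well defined and $$\Psi_{F'}(\psi_F)=\begin{cases}1 & \text{if } F'=F,\\ 0 & \text{if } F'\neq F.\end{cases}$$
   Context: Simplices. For a finite nonempty set $V$, $T_V=\{(\lambda_i)_{i\in V}\in\mathbb{R}_{\ge 0}^V : \sum_{i\in V}\lambda_i=1\}$, of dimension $n=|V|-1$; $\mathring T$ denotes the interior (all $\lambda_i>0$). An orientation of $V$ is an ordering modulo even permutations, equivalently an orientation of $\mathbb{R}^V$, equivalently an orientation of $T_V$ via the outward normal. An orientation of $T_W$ is fixed once and for all for every nonempty $W\subseteq V$. Flags. A flag on $V$ is an ordered partition $F=(V_0,\dots,V_{n-k})$ of $V$ into nonempty sets. Put $J=\{0,\dots,n-k\}$, $T_j=T_{V_j}$. Let $R=R_F=T_J$ be the simplex with barycentric coordinates $\rho_0,\dots,\rho_{n-k}$ (points denoted $\boldsymbol\rho$), and $\Theta=\Theta_F=\prod_{j\in J}T_j=\{(\theta_i)_{i\in V}\in\mathbb{R}_{\ge0}^V:\sum_{i\in V_j}\theta_i=1\ \forall j\}$, of dimension $k$, with the product orientation. The quasi-cylindrical coordinate map $\Phi:R\times\Theta\to T$ is $\lambda_i=\rho_j\theta_i$ for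 $i\in V_j$; it restricts to a diffeomorphism $\mathring R\times\mathring\Theta\to\mathring T$, and $R$ is oriented so that this diffeomorphism preserves orientation. Blow-up Whitney forms. Let $\omega$ be the constant multiple of the volume form on $T$ with $\int_T\omega=1$. For $\boldsymbol\rho\in\mathring R$ let $$R_{\boldsymbol\rho}=\Big\{(r_0,\dots,r_{n-k})\in R : \tfrac{r_{j-1}}{\rho_{j-1}}\le\tfrac{r_j}{\rho_j}\text{ for all }1\le j\le n-k\Big\}.$$ Let $\psi_{F,\boldsymbol\rho}=\int_{R_{\boldsymbol\rho}}\Phi^*\omega$ be the $k$-form on $\mathring\Theta$ obtained by integrating $\Phi^*\omega$ over the $R$-factor (fiber integration over $R_{\boldsymbol\rho}$, with sign convention such that $\int_\Theta\int_{R_{\boldsymbol\rho}}\Phi^*\omega=\int_{R_{\boldsymbol\rho}\times\Theta}\Phi^*\omega$). The blow-up Whitney form $\psi_F$ is the $k$-form on $\mathring T$ whose value at $x=\Phi(\boldsymbol\rho,\boldsymbol\theta)$ on vectors $X_1,\dots,X_k$ is $\psi_{F,\boldsymbol\rho}(Y_1,\dots,Y_k)$ at $\boldsymbol\theta$, where $Y_1,\dots,Y_k$ are the projections of $X_1,\dots,X_k$ to the $\Theta$ factor. Degrees of freedom. For a $k$-form $\psi$ on $\mathring T$ and $\boldsymbol\rho\in\mathring R_F$, let $\psi_{\boldsymbol\rho}$ be the pullback of $\psi$ to $\mathring\Theta_F$ under the inclusion $\boldsymbol\theta\mapsto\Phi(\boldsymbol\rho,\boldsymbol\theta)$. Define $$\Psi_F(\psi)=\int_{\Theta_F}\lim_{\rho_1\to0}\cdots\lim_{\rho_{n-k}\to0}\psi_{\boldsymbol\rho},$$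 where the limits are iterated (the innermost limit $\rho_{n-k}\to0$ is taken first, while the remaining $\rho_j$ stay nonzero until their own limit is taken; $\rho_0=1-\rho_1-\dots-\rho_{n-k}$) and are taken pointwise on $\mathring\Theta_F$, before integrating. *)

(* Defs.v *)
From HB Require Import structures.
From mathcomp Require Import all_boot all_order all_algebra.
From mathcomp Require Import all_classical all_reals all_analysis.

Set Implicit Arguments.
Unset Strict Implicit.
Unset Printing Implicit Defensive.

Import Order.TTheory GRing.Theory Num.Theory.
Import numFieldNormedType.Exports.

Local Open Scope classical_set_scope.
Local Open Scope ring_scope.

(* lebesgue_tuple R d, below, is Lebesgue measure on R^d, R^d being the type of
   d-tuples with its product sigma-algebra. *)

Definition tuple_cons (R : realType) (d : nat)
    (p : measurableTypeR R * d.-tuple (measurableTypeR R)) :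
  d.+1.-tuple (measurableTypeR R) := [tuple of p.1 :: p.2].

Lemma measurable_tuple_cons (R : realType) (d : nat) :
  measurable_fun [set: measurableTypeR R * d.-tuple (measurableTypeR R)] (@tuple_cons R d).
Proof. exact: measurable_cons. Qed.

Definition lebesgue_cons (R : realType) (d : nat)
    (mu : {sigma_finite_measure set (d.-tuple (measurableTypeR R)) -> \bar R}) :
    set (d.+1.-tuple (measurableTypeR R)) -> \bar R :=
  pushforward (lebesgue_measure \x mu)%E (@tuple_cons R d).

Lemma lebesgue_cons0 (R : realType) (d : nat)
    (mu : {sigma_finite_measure set (d.-tuple (measurableTypeR R)) -> \bar R}) :
  lebesgue_cons mu set0 = 0%E.
Proof. by rewrite /lebesgue_cons /pushforward preimage_set0 measure0. Qed.

Lemma lebesgue_cons_ge0 (R : realType) (d : nat)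
    (mu : {sigma_finite_measure set (d.-tuple (measurableTypeR R)) -> \bar R}) A :
  (0 <= lebesgue_cons mu A)%E.
Proof. by rewrite /lebesgue_cons /pushforward measure_ge0. Qed.

Lemma lebesgue_cons_sigma_additive (R : realType) (d : nat)
    (mu : {sigma_finite_measure set (d.-tuple (measurableTypeR R)) -> \bar R}) :
  semi_sigma_additive (lebesgue_cons mu).
Proof.
move=> F mF tF mUF; rewrite /lebesgue_cons /pushforward preimage_bigcup.
apply: measure_semi_sigma_additive.
- by move=> i; rewrite -[X in measurable X]setTI; exact: measurable_tuple_cons.
- apply/trivIsetP => /= i j _ _ ij; rewrite -preimage_setI.
  by move/trivIsetP : tF => /(_ _ _ _ _ ij) ->//; rewrite preimage_set0.
- rewrite -preimage_bigcup -[X in measurable X]setTI.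
  exact: measurable_tuple_cons.
Qed.

HB.instance Definition _ (R : realType) (d : nat)
    (mu : {sigma_finite_measure set (d.-tuple (measurableTypeR R)) -> \bar R}) :=
  isMeasure.Build _ _ _ (lebesgue_cons mu) (lebesgue_cons0 mu)
    (lebesgue_cons_ge0 mu) (@lebesgue_cons_sigma_additive R d mu).

Lemma lebesgue_cons_sigma_finite (R : realType) (d : nat)
    (mu : {sigma_finite_measure set (d.-tuple (measurableTypeR R)) -> \bar R}) :
  sigma_finite setT (lebesgue_cons mu).
Proof.
have /sigma_finiteP[F [FT F_nd mF]] :=
  sigma_finiteT (@lebesgue_measure R : {sigma_finite_measure set _ -> \bar R}).
have /sigma_finiteP[G [GT G_nd mG]] := sigma_finiteT mu.
exists (fun i => [set t | F i (thead t) /\ G i [tuple of behead t]]).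
  apply/seteqP; split => // t _.
  have : (\bigcup_i F i) (thead t) by rewrite -FT.
  have : (\bigcup_i G i) [tuple of behead t] by rewrite -GT.
  move=> [k _ Gk] [i _ Fi]; exists (maxn i k) => //; split.
    by move: Fi; exact/subsetPset/F_nd/leq_maxl.
  by move: Gk; exact/subsetPset/G_nd/leq_maxr.
move=> i; have [mFi Fi] := mF i; have [mGi Gi] := mG i; split.
  apply: measurableI.
    rewrite -[X in measurable X]setTI.
    exact: (@measurable_tnth _ (measurableTypeR R) _ ord0).
  rewrite -[X in measurable X]setTI.
  exact: (@measurable_behead _ (measurableTypeR R)).
rewrite /lebesgue_cons /pushforward (_ : _ @^-1` _ = F i `*` G i).
  by rewrite product_measure1E// lte_mul_pinfty// ge0_fin_numE.
apply/seteqP; split => -[x t] /=; rewrite theadE.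
  by move=> [Fx Gt]; split => //=;
    rewrite (_ : t = [tuple of behead (x :: t)]) //; exact: val_inj.
by move=> [/= Fx Gt]; split => //;
  rewrite (_ : [tuple of behead (x :: t)] = t) //; exact: val_inj.
Qed.

HB.instance Definition _ (R : realType) (d : nat)
    (mu : {sigma_finite_measure set (d.-tuple (measurableTypeR R)) -> \bar R}) :=
  Measure_isSigmaFinite.Build _ _ _ (lebesgue_cons mu)
    (@lebesgue_cons_sigma_finite R d mu).

Fixpoint lebesgue_tuple (R : realType) (d : nat) :
    {sigma_finite_measure set (d.-tuple (measurableTypeR R)) -> \bar R} :=
  match d with
  | 0 => \d_([tuple] : 0.-tuple (measurableTypeR R))
  | d'.+1 => lebesgue_cons (lebesgue_tuple R d')
  end.

(* Differential forms.  A point of a simplex, or of a product of simplices, is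
   a point of the ambient space I -> R (resp. of a product of such spaces), and
   a form is a function of a point and of ambient vectors; only its values on
   vectors tangent to the simplex are meaningful.  Multilinearity, alternation
   and smoothness are properties of the forms constructed below, not part of the
   type. *)

Definition form (R : realType) (E : lmodType R) (k : nat) : Type :=
  E -> ('I_k -> E) -> R.

(* The differential of f at x, applied to X. *)
Definition tdiff (R : realType) (E : lmodType R) (I : Type) (f : E -> I -> R)
    (x X : E) : I -> R :=
  fun i => derive1 (fun t : R => f (x + t *: X) i) 0.

Definition pullback (R : realType) (E : lmodType R) (I : Type) (k : nat)
    (f : E -> I -> R) (alpha : form (I -> R) k) : form E k :=
  fun x X => alpha (f x) (fun a => tdiff f x (X a)).

(* Products of simplices.  For pairwise disjoint sets W in P covering I, this is
   the product of the T_W; in particular [:: setT] gives the simplex T_I. *)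

Definition simplices (R : realType) (I : finType) (P : seq {set I}) :
    set (I -> R) :=
  [set x | (forall i, 0 <= x i) /\
           (forall W : {set I}, W \in P -> \sum_(i in W) x i = 1)].

Definition open_simplices (R : realType) (I : finType) (P : seq {set I}) :
    set (I -> R) :=
  [set x | (forall i, 0 < x i) /\
           (forall W : {set I}, W \in P -> \sum_(i in W) x i = 1)].

Definition tangent (R : realType) (I : finType) (P : seq {set I}) :
    set (I -> R) :=
  [set X | forall W : {set I}, W \in P -> \sum_(i in W) X i = 0].

(* An orientation of W is represented by an ordering of W; a family of orderings
   s_0, ..., s_p of disjoint sets represents the product orientation.

   For the ordering w_0, ..., w_d of W, the frame of T_W made of the vectors
   e_(w_a) - e_(w_0), 1 <= a <= d, is positively oriented: the determinant of
   the outward normal followed by this frame is positive in R^W.  Concatenating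
   these frames gives a positive frame of the product, hence an oriented affine
   chart. *)

Definition edges (R : realType) (I : finType) (s : seq I) : seq (I -> R) :=
  if s is i :: s' then [seq (fun l => (l == j)%:R - (l == i)%:R) | j <- s']
  else [::].

Definition frame (R : realType) (I : finType) (ss : seq (seq I)) (a : nat) :
    I -> R :=
  nth 0 (flatten [seq edges R s | s <- ss]) a.

Definition chart (R : realType) (I : finType) (ss : seq (seq I)) (d : nat)
    (u : d.-tuple (measurableTypeR R)) : I -> R :=
  fun i => (i \in pmap ohead ss)%:R + \sum_(a < d) tnth u a * frame R ss a i.

Definition integral_form (R : realType) (I : finType) (ss : seq (seq I))
    (d : nat) (S : set (I -> R)) (alpha : form (I -> R) d) : R :=
  \int[lebesgue_tuple R d]_(u in @chart R I ss d @^-1` S)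
    alpha (chart ss u) (fun a => frame R ss a).

Definition integrable_form (R : realType) (I : finType) (ss : seq (seq I))
    (d : nat) (S : set (I -> R)) (alpha : form (I -> R) d) : Prop :=
  (lebesgue_tuple R d).-integrable (@chart R I ss d @^-1` S)
    (fun u => (alpha (chart ss u) (fun a => frame R ss a))%:E).

(* Riemannian volume form of the d-dimensional simplex T_I, oriented by the
   ordering s of I: the determinant in R^I of the unit outward normal followed
   by the given vectors. *)
Definition volume_form (R : realType) (I : finType) (s : seq I) (d : nat) :
    form (I -> R) d :=
  fun _ X => \det (\matrix_(a < d.+1, b < d.+1)
    [seq (if unlift ord0 a is Some c then X c i else (Num.sqrt d.+1%:R)^-1)
    | i <- s]`_b).

Definition unit_volume_form (R : realType) (I : finType) (s : seq I)
    (d : nat) : form (I -> R) d :=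
  fun x X =>
    (integral_form [:: s] (simplices [:: [set: I]%SET]) (@volume_form R I s d))^-1
    * volume_form s x X.

Definition is_flag (V : finType) (m : nat) (F : m.+1.-tuple {set V}) : bool :=
  uniq F && finset.partition [set W in F]%SET [set: V]%SET.

(* The index j such that i belongs to the j-th set of the flag F. *)
Definition part (V : finType) (m : nat) (F : m.+1.-tuple {set V}) (i : V) :
    'I_m.+1 :=
  inord (find (fun W : {set V} => i \in W) F).

Lemma part_flag (V : finType) (m : nat) (F : m.+1.-tuple {set V}) (i : V)
    (j : 'I_m.+1) : is_flag F -> (part F i == j) = (i \in tnth F j).
Proof.
move=> /andP[uF /and3P[/eqP cF tF _]].
have iF : has (fun W : {set V} => i \in W) F.
  have : i \in finset.cover [set W in F]%SET by rewrite cF inE.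
  by move=> /bigcupP[W]; rewrite inE => WF iW; apply/hasP; exists W.
have lt : (find (fun W : {set V} => i \in W) F < m.+1)%N.
  by move: iF; rewrite has_find size_tuple.
have iP : i \in tnth F (part F i).
  by rewrite (tnth_nth finset.set0) /part inordK//; exact: (nth_find _ iF).
apply/eqP/idP => [<-//|ij]; apply/eqP.
have /finset.trivIsetP tF' := tF.
apply/negPn/negP => ne.
have /tF' : tnth F (part F i) \in [set W in F]%SET by rewrite inE mem_tnth.
move=> /(_ (tnth F j)); rewrite inE mem_tnth => /(_ isT) dis.
have /dis /pred0P /(_ i) /= : tnth F (part F i) != tnth F j.
  by apply: contra ne => /eqP e; apply/eqP/(tuple_uniqP _ uF).
by rewrite iP ij.
Qed.

Definition Phi (R : realType) (V : finType) (m : nat)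
    (F : m.+1.-tuple {set V}) (p : ('I_m.+1 -> R) * (V -> R)) : V -> R :=
  fun i => p.1 (part F i) * p.2 i.

Definition rho_coord (R : realType) (V : finType) (m : nat)
    (F : m.+1.-tuple {set V}) (x : V -> R) : 'I_m.+1 -> R :=
  fun j => \sum_(i in tnth F j) x i.

Definition theta_coord (R : realType) (V : finType) (m : nat)
    (F : m.+1.-tuple {set V}) (x : V -> R) : V -> R :=
  fun i => x i / rho_coord F x (part F i).

(* rho_coord F and theta_coord F are the components of the inverse of Phi F. *)

Lemma rho_coordK (R : realType) (V : finType) (m : nat)
    (F : m.+1.-tuple {set V}) (rho : 'I_m.+1 -> R) (theta : V -> R) :
  is_flag F -> simplices F theta -> rho_coord F (Phi F (rho, theta)) = rho.
Proof.
move=> fF [_ th]; apply/funext => j; rewrite /rho_coord /Phi /=.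
rewrite (eq_bigr (fun i => rho j * theta i)); last first.
  by move=> i; rewrite -(part_flag i j fF) => /eqP ->.
by rewrite -mulr_sumr th ?mulr1// mem_tnth.
Qed.

Lemma theta_coordK (R : realType) (V : finType) (m : nat)
    (F : m.+1.-tuple {set V}) (rho : 'I_m.+1 -> R) (theta : V -> R) :
  is_flag F -> (forall j, rho j != 0) -> simplices F theta ->
  theta_coord F (Phi F (rho, theta)) = theta.
Proof.
move=> fF rho0 th; apply/funext => i; rewrite /theta_coord rho_coordK//.
by rewrite /Phi /= mulrC mulKf.
Qed.

Definition open_R (R : realType) (m : nat) : set ('I_m.+1 -> R) :=
  open_simplices [:: [set: 'I_m.+1]%SET].

Definition R_sub (R : realType) (m : nat) (rho : 'I_m.+1 -> R) :
    set ('I_m.+1 -> R) :=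
  [set r | simplices [:: [set: 'I_m.+1]%SET] r /\
           (forall i j : 'I_m.+1, j = i.+1 :> nat -> r i / rho i <= r j / rho j)].

(* The vectors (X_1, 0), ..., (X_m, 0), (0, Y_1), ..., (0, Y_k). *)
Definition prod_vectors (E E' : zmodType) (m k : nat) (X : 'I_m -> E)
    (Y : 'I_k -> E') : 'I_(m + k) -> (E * E')%type :=
  fun c => match fintype.split c with inl a => (X a, 0) | inr b => (0, Y b) end.

(* The ordering sR orients R so that Phi : R x Theta -> T preserves orientation;
   o W is the ordering of W giving the orientation of T_W. *)
Definition R_oriented (R : realType) (V : finType) (m k : nat)
    (o : {set V} -> seq V) (F : m.+1.-tuple {set V}) (sR : seq 'I_m.+1) : Prop :=
  perm_eq sR (enum 'I_m.+1) /\
  forall (rho : 'I_m.+1 -> R) (theta : V -> R),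
    open_R rho -> open_simplices F theta ->
    0 < pullback (Phi F) (@volume_form R V (o [set: V]%SET) (m + k)) (rho, theta)
          (prod_vectors (fun a : 'I_m => frame R [:: sR] a)
                        (fun b : 'I_k => frame R (map o F) b)).

(* Integration over the first factor; putting the vectors tangent to it first
   is what makes Fubini hold without sign for the product orientation. *)
Definition fiber_integral (R : realType) (I V : finType) (m k : nat)
    (ss : seq (seq I)) (S : set (I -> R))
    (alpha : form ((I -> R) * (V -> R))%type (m + k)) : form (V -> R) k :=
  fun theta Y => \int[lebesgue_tuple R m]_(u in @chart R I ss m @^-1` S)
    alpha (chart ss u, theta) (prod_vectors (fun a : 'I_m => frame R ss a) Y).

Definition whitney_at (R : realType) (V : finType) (m k : nat)
    (o : {set V} -> seq V) (F : m.+1.-tuple {set V}) (sR : seq 'I_m.+1)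
    (rho : 'I_m.+1 -> R) : form (V -> R) k :=
  fiber_integral [:: sR] (R_sub rho)
    (pullback (Phi F) (@unit_volume_form R V (o [set: V]%SET) (m + k))).

(* The blow-up Whitney form psi_F; the differential of theta_coord F is the
   projection to the tangent space of the Theta factor. *)
Definition whitney (R : realType) (V : finType) (m k : nat)
    (o : {set V} -> seq V) (F : m.+1.-tuple {set V}) (sR : seq 'I_m.+1) :
    form (V -> R) k :=
  fun x X => whitney_at o F sR (rho_coord F x) (theta_coord F x)
    (fun a => tdiff (theta_coord F) x (X a)).

(* Iterated one-sided limits: the limit in the head of the sequence is the
   outermost one. *)

Fixpoint iter_lim (R : realType) (m : nat) (f : seq R -> R) : R :=
  match m with
  | 0 => f [::]
  | m'.+1 => lim (iter_lim m' (fun s => f (x :: s)) @[x --> 0^'+])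
  end.

(* Existence of these limits, the variables still present being positive with
   sum less than b. *)
Fixpoint iter_lim_exists (R : realType) (m : nat) (b : R) (f : seq R -> R) :
    Prop :=
  match m with
  | 0 => True
  | m'.+1 =>
      (forall x, 0 < x < b -> iter_lim_exists m' (b - x) (fun s => f (x :: s))) /\
      cvg (iter_lim m' (fun s => f (x :: s)) @[x --> 0^'+])
  end.

Definition rho_of_seq (R : realType) (m : nat) (s : seq R) : 'I_m.+1 -> R :=
  fun j => (1 - \sum_(x <- s) x :: s)`_j.

Definition trace (R : realType) (V : finType) (m k : nat)
    (F : m.+1.-tuple {set V}) (psi : form (V -> R) k) (rho : 'I_m.+1 -> R) :
    form (V -> R) k :=
  pullback (fun theta => Phi F (rho, theta)) psi.

Definition trace_lim (R : realType) (V : finType) (m k : nat)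
    (F : m.+1.-tuple {set V}) (psi : form (V -> R) k) : form (V -> R) k :=
  fun theta Y => iter_lim m (fun s => trace F psi (rho_of_seq s) theta Y).

Definition dof (R : realType) (V : finType) (m k : nat)
    (o : {set V} -> seq V) (F : m.+1.-tuple {set V}) (psi : form (V -> R) k) : R :=
  integral_form (map o F) (open_simplices F) (trace_lim F psi).

Definition dof_defined (R : realType) (V : finType) (m k : nat)
    (o : {set V} -> seq V) (F : m.+1.-tuple {set V}) (psi : form (V -> R) k) :
    Prop :=
  (forall (theta : V -> R) (Y : 'I_k -> V -> R),
     open_simplices F theta -> (forall b, tangent F (Y b)) ->
     iter_lim_exists m 1 (fun s => trace F psi (rho_of_seq s) theta Y)) /\
  integrable_form (map o F) (open_simplices F) (trace_lim F psi).

(* Main.v *)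
Require Import Defs.
From HB Require Import structures.
From mathcomp Require Import all_boot all_order all_algebra.
From mathcomp Require Import all_classical all_reals all_analysis.
From mathcomp Require Import perm measurable_realfun zify ring lra.

(** Why the Whitney forms and the degrees of freedom are dual.

    In the coordinates (r, theta) of a flag F the volume form of T is a
    determinant whose rows can be rearranged and rescaled block by block.  It
    splits as a constant times the volume form of R, times the monomial
    prod_j r_j ^ (|V_j| - 1), times the determinant det(theta; Y) of the matrix
    whose first rows are the restrictions of theta to the blocks of F and whose
    remaining rows are the vectors Y ([pullback_volume], [det_part_scale]).  The
    last factor is the volume form of Theta: it does not depend on theta.  So
    psi_F at a point with first coordinate rho is, up to a constant, det(theta; Y)
    times the integral of the monomial over R_rho, called [chain_moment]
    ([whitney_atE]).

    Restricting psi_F to a fibre of another flag F' replaces theta by the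
    F-coordinates of the point x = Phi_F'(rho', theta').  Passing from these back
    to theta' only adds multiples of the first rows to the others and rescales
    the columns, so all dependence on rho' is explicit ([trace_whitneyE]): the
    trace is
      constant * chain_moment(rho) * prod_i (rho'_a(i) / rho_j(i)) * det(theta'; Y)
    where rho is the first F-coordinate of x, whose entries are linear forms in
    rho' with nonnegative coefficients, and a(i), j(i) are the blocks of F', F
    containing the element i of V.

    The iterated limits are then limits of quotients of linear forms and of
    integrals of indicators of half-spaces in rho'.  Such quotients and signs
    have iterated limits, read off lexicographically from the coefficients
    ([iterlim_to_lexratio], [iterlim_to_lexneg]), and dominated convergence moves
    the limits inside the integral ([iterlim_to_integral]).

    If F' = F, every quotient is 1, the half-space conditions all become true,
    and the limit is the full Dirichlet integral of the monomial, times
    det(theta; Y) ([limit_diagonal]).  The remaining integral over Theta is a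
    product of volumes of simplices, the factorials cancel, and the frame
    determinants, which are 1 up to sign, multiply to 1 by the choice of the
    orientation of R ([oriented_det1]).

    If F' <> F ([limit_off_diagonal]), either some element i lies in an F-block
    that meets a block of F' earlier than that of i, and its quotient tends to 0;
    or F' lists the blocks of F in another order, two consecutive blocks of F are
    reversed in F', and the corresponding condition defining R_rho fails in the
    limit at every interior point of R. *)

Set Implicit Arguments.
Unset Strict Implicit.
Unset Printing Implicit Defensive.

Import Order.TTheory GRing.Theory Num.Theory.
Import numFieldNormedType.Exports.

Local Open Scope classical_set_scope.
Local Open Scope ring_scope.

(** * Iterated limits *)

(** Relational form of the iterated one-sided limit. It bundles the existence of all
    inner limits with the value, so that products and integrals can be treated by
    one induction; the inner limits are only asked for on the corner simplex of
    size b, where the trace formula is valid. *)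
Fixpoint iterlim_to (R : realType) (m : nat) (b : R) (f : seq R -> R) (l : R) : Prop :=
  match m with
  | 0 => f [::] = l
  | m'.+1 => exists2 g : R -> R,
      (forall x, 0 < x < b -> iterlim_to m' (b - x) (fun s => f (x :: s)) (g x))
      & g x @[x --> 0^'+] --> l
  end.

Lemma near0_itv (R : realType) (b : R) : 0 < b -> \forall x \near 0^'+, 0 < x < b.
Proof.
move=> b0; near=> x; apply/andP; split => //.
Unshelve. all: by end_near. Qed.

Lemma iterlim_toP (R : realType) m (b : R) f l : 0 < b -> iterlim_to m b f l ->
  iter_lim_exists m b f /\ iter_lim m f = l.
Proof.
elim: m b f l => [|m IH] b f l b0 //= [g gP gl].
have H : iter_lim m (fun s => f (x :: s)) @[x --> 0^'+] --> l.
  apply: cvg_trans gl; apply: near_eq_cvg; near=> x.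
  have xb : 0 < x < b by near: x; exact: near0_itv.
  have bx : 0 < b - x by rewrite subr_gt0; case/andP: xb.
  by have [_ ->] := IH (b - x) _ _ bx (gP x xb).
split; last exact: cvg_lim.
split; last by apply/cvg_ex; exists l.
move=> x xb; have bx : 0 < b - x by rewrite subr_gt0; case/andP: xb.
by have [] := IH (b - x) _ _ bx (gP x xb).
Unshelve. all: by end_near. Qed.

Definition seq_dom (R : realType) (m : nat) (b : R) (s : seq R) : Prop :=
  [/\ size s = m, (forall x, x \in s -> 0 < x) & \sum_(x <- s) x < b].

Lemma seq_dom_cons (R : realType) m (b x : R) s : 0 < x ->
  seq_dom m (b - x) s -> seq_dom m.+1 b (x :: s).
Proof.
move=> x0 [<- sp sb]; split => //.
  by move=> y; rewrite inE => /predU1P[->//|]; exact: sp.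
by rewrite big_cons addrC -ltrBrDr.
Qed.

(** Formulas for the trace hold on the open corner simplex only; the iterated limit
    sees nothing else. *)
Lemma eq_iterlim_to (R : realType) m (b : R) f g l :
  (forall s, seq_dom m b s -> f s = g s) -> 0 < b ->
  iterlim_to m b f l -> iterlim_to m b g l.
Proof.
elim: m b f g l => [|m IH] b f g l fg b0 /=.
  by rewrite fg //; split => //; rewrite big_nil.
move=> [h hP hl]; exists h => // x xb.
have /andP[x0 xb'] := xb.
apply: IH (hP x xb); last by rewrite subr_gt0.
by move=> s sP; apply: fg; exact: seq_dom_cons.
Qed.

Lemma iterlim_to_cst (R : realType) m (b : R) k : iterlim_to m b (fun=> k) k.
Proof. by elim: m b => [|m IH] b //=; exists (fun=> k) => //; exact: cvg_cst. Qed.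

Lemma iterlim_toM (R : realType) m (b : R) f g l l' :
  iterlim_to m b f l -> iterlim_to m b g l' ->
  iterlim_to m b (fun s => f s * g s) (l * l').
Proof.
elim: m b f g l l' => [|m IH] b f g l l' /=; first by move=> -> ->.
move=> [h hP hl] [h' hP' hl']; exists (fun x => h x * h' x); last exact: cvgM.
by move=> x xb; apply: IH; [exact: hP|exact: hP'].
Qed.

Lemma iterlim_to_prod (R : realType) m (b : R) (I : Type) (r : seq I) (P : pred I)
    (f : I -> seq R -> R) (l : I -> R) :
  (forall i, P i -> iterlim_to m b (f i) (l i)) ->
  iterlim_to m b (fun s => \prod_(i <- r | P i) f i s) (\prod_(i <- r | P i) l i).
Proof.
move=> H; elim: r => [|i r IH].
  rewrite big_nil; under [X in iterlim_to _ _ X]funext do rewrite big_nil.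
  exact: iterlim_to_cst.
rewrite big_cons; under [X in iterlim_to _ _ X]funext do rewrite big_cons.
by case: ifPn => // Pi; apply: iterlim_toM => //; exact: H.
Qed.

(** Dominated convergence at each of the m stages. Measurability and the bound are
    part of the conclusion because the next stage needs them for the partial
    limits; one-sided limits are tested along sequences. *)
Lemma iterlim_to_integral (R : realType) d (T : measurableType d)
    (mu : {measure set T -> \bar R}) (D : set T) m (b : R) (f : seq R -> T -> R)
    (l h : T -> R) :
  measurable D -> mu.-integrable D (EFin \o h) -> 0 < b ->
  (forall s, seq_dom m b s -> measurable_fun D (f s)) ->
  (forall s u, seq_dom m b s -> D u -> `|f s u| <= h u) ->
  (forall u, D u -> iterlim_to m b (f ^~ u) (l u)) ->
  [/\ iterlim_to m b (fun s => \int[mu]_(u in D) f s u) (\int[mu]_(u in D) l u),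
      measurable_fun D l & forall u, D u -> `|l u| <= h u].
Proof.
move=> mD ih; elim: m b f l => [|m IH] b f l b0 mf bf fl /=.
  have s0 : seq_dom 0 b [::] by split => //; rewrite big_nil.
  split.
  - by apply: eq_Rintegral => u; rewrite inE => /fl /= ->.
  - by apply: eq_measurable_fun (mf _ s0) => u; rewrite inE => /fl /= ->.
  - by move=> u Du; rewrite -(fl u Du) /=; exact: bf.
have /choice[G GP] : forall u, exists g : R -> R, D u ->
    (forall x, 0 < x < b -> iterlim_to m (b - x) (fun s => f (x :: s) u) (g x))
    /\ g x @[x --> 0^'+] --> l u.
  move=> u; have [Du|nDu] := pselect (D u); last by exists (fun=> 0).
  by have [g gP gl] := fl u Du; exists g.
have {}IH x : 0 < x < b ->
  [/\ iterlim_to m (b - x) (fun s => \int[mu]_(u in D) f (x :: s) u) (\int[mu]_(u in D) G u x),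
      measurable_fun D (G ^~ x) & forall u, D u -> `|G u x| <= h u].
  move=> xb; have /andP[x0 xb'] := xb.
  apply: IH.
  - by rewrite subr_gt0.
  - by move=> s sP; apply: mf; exact: seq_dom_cons.
  - by move=> s u sP Du; apply: bf => //; exact: seq_dom_cons.
  - by move=> u Du; have [+ _] := GP u Du; apply.
have seqP (v : R^nat) : (forall n, 0 < v n < b) -> v n @[n --> \oo] --> (0 : R) ->
    [/\ measurable_fun D l, forall u, D u -> `|l u| <= h u &
     (\int[mu]_(u in D) G u (v n)) @[n --> \oo] --> \int[mu]_(u in D) l u].
  move=> vb v0.
  have cv u : D u -> G u (v n) @[n --> \oo] --> l u.
    move=> Du; have [_ /cvg_at_rightP] := GP u Du; apply; split => // n.
    by case/andP: (vb n).
  have ml : measurable_fun D l.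
    apply: (measurable_fun_cvg (h := fun n u => G u (v n))) => //.
    by move=> n; have [] := IH _ (vb n).
  have bl u : D u -> `|l u| <= h u.
    move=> Du; apply: (cvgr_to_le (cvg_norm (cv u Du))).
    by apply: nearW => n; have [_ _] := IH _ (vb n); apply.
  split => //.
  have [] := @dominated_convergence _ _ _ mu D mD (fun n u => (G u (v n))%:E)
      (EFin \o l) (EFin \o h) => //.
  - by move=> n; apply/measurable_EFinP; have [] := IH _ (vb n).
  - exact/measurable_EFinP.
  - by apply: aeW => u Du; apply/fine_cvgP; split; [exact: nearW|exact: cv].
  - by apply: aeW => u n Du; rewrite lee_fin; have [_ _] := IH _ (vb n); apply.
  move=> il _ c.
  apply: fine_cvg; rewrite fineK//; exact: integrable_fin_num.
split.
- exists (fun x => \int[mu]_(u in D) G u x).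
    by move=> x xb; have [] := IH _ xb.
  apply/cvg_at_rightP => v [v0 v1].
  (* the sequence may leave the corner simplex finitely often; b / 2 is a harmless stand-in *)
  pose w n := if v n < b then v n else b / 2.
  have wb n : 0 < w n < b.
    rewrite /w; case: ifPn => [->|_]; first by rewrite v0.
    by apply/andP; split; lra.
  have vw : \forall n \near \oo, v n = w n.
    near=> n; rewrite /w ifT//; near: n.
    by apply: (cvgr_lt _ v1).
  have w0 : w n @[n --> \oo] --> (0 : R).
    by apply: cvg_trans v1; apply: near_eq_cvg; apply: filterS vw => n ->.
  have [_ _] := seqP w wb w0.
  apply: cvg_trans; apply: near_eq_cvg.
  by apply: filterS vw => n ->.
all: pose w n := b / 2 * (n.+1%:R : R)^-1.
all: have wb n : 0 < w n < b by
  rewrite /w mulr_gt0 ?invr_gt0 ?divr_gt0//= (@le_lt_trans _ _ (b / 2))//; last lra;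
  rewrite ler_piMr ?invr_le1 ?ler1n ?unitfE ?pnatr_eq0//; lra.
all: have w0 : w n @[n --> \oo] --> (0 : R) by
  rewrite -(mulr0 (b / 2)); apply: cvgM; [exact: cvg_cst|exact: cvg_harmonic].
all: by have [] := seqP w wb w0.
Unshelve. all: by end_near. Qed.

(** * Iterated limits of signs and quotients of affine functions *)

(** The affine function a + sum_l b_l s_l, written so that fixing the first variable
    gives again such a function, with a new constant term. *)
Fixpoint aff (R : realType) (a : R) (bs s : seq R) : R :=
  match bs, s with
  | b :: bs', x :: s' => aff (a + b * x) bs' s'
  | _, _ => a
  end.

Lemma affE (R : realType) (a : R) bs s : size bs = size s ->
  aff a bs s = a + \sum_(i < size s) bs`_i * s`_i.
Proof.
elim: s a bs => [|x s IH] a [|b bs] //=; first by rewrite big_ord0 addr0.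
by move=> [e]; rewrite IH// big_ord_recl /= addrA.
Qed.

(** The first nonzero entry, if any, is negative: the sign of an affine function for
    s_0 much larger than s_1, much larger than s_2, and so on, all infinitesimal. *)
Fixpoint lexneg (R : realType) (s : seq R) : bool :=
  if s is a :: s' then (a < 0) || ((a == 0) && lexneg s') else true.

(** The quotient of the leading coefficients, the leading term being that of the
    denominator. *)
Fixpoint lexratio (R : realType) (s t : seq R) : R :=
  match s, t with
  | a :: s', c :: t' => if c == 0 then lexratio s' t' else a / c
  | _, _ => 0
  end.

Lemma cvg_affine_right (R : realType) (a b : R) : a + b * x @[x --> 0^'+] --> a.
Proof.
have H : {for 0, continuous (fun x : R => a + b * x)}.
  by move=> y; apply: cvgD; [exact: cvg_cst|apply: cvgM; [exact: cvg_cst|exact: cvg_id]].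
by move: (cvg_at_right_filter H); rewrite mulr0 addr0.
Qed.

(** After the inner limits the sign is decided by the constant term a + c x or, if it
    vanishes, by the later coefficients; for small x > 0 this is constant in x. *)
Lemma iterlim_to_lexneg (R : realType) (bs : seq R) (a b : R) :
  iterlim_to (size bs) b (fun s => (aff a bs s <= 0)%R%:R) (lexneg (a :: bs))%:R.
Proof.
elim: bs a b => [|c bs IH] a b /=; first by rewrite andbT le_eqVlt orbC.
exists (fun x => (lexneg (a + c * x :: bs))%:R); first by move=> x _; exact: IH.
apply: cvg_near_cst => /=; have [a0|a0|->] := ltgtP a 0.
- near=> x; have -> // : a + c * x < 0.
  by near: x; exact: (cvgr_lt _ (@cvg_affine_right R a c)).
- near=> x; have ax : 0 < a + c * x.
    by near: x; exact: (cvgr_gt _ (@cvg_affine_right R a c)).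
  by rewrite lt_gtF// gt_eqF.
- near=> x; have x0 : 0 < x by [].
  by rewrite add0r pmulr_llt0// mulf_eq0 (gt_eqF x0) orbF.
Unshelve. all: by end_near. Qed.

(** Both bounds hold at the two ends of a segment, hence along it. *)
Lemma convex_between (R : realType) (y a e c f : R) : 0 <= y <= 1 ->
  0 <= a <= c -> 0 <= a + e <= c + f -> 0 <= a + y * e <= c + y * f.
Proof.
move=> /andP[y0 y1] /andP[a0 ac] /andP[e0 ef].
have E z w : z + y * w = (1 - y) * z + y * (z + w) by ring.
by rewrite (E a e) (E c f) addr_ge0 ?lerD ?mulr_ge0 ?ler_wpM2l// subr_ge0.
Qed.

(** The hypotheses say that 0 <= numerator <= denominator at the vertices of the corner
    simplex of size b; they are inherited by the sections at fixed first variable,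
    whose vertices lie on edges. They ensure that a vanishing leading coefficient of
    the denominator forces that of the numerator to vanish. *)
Lemma iterlim_to_lexratio (R : realType) (bs ds : seq R) (a c b : R) :
  size bs = size ds -> 0 < b -> 0 <= a <= c ->
  (forall i, (i < size bs)%N -> 0 <= a + bs`_i * b <= c + ds`_i * b) ->
  iterlim_to (size bs) b (fun s => aff a bs s / aff c ds s)
    (lexratio (a :: bs) (c :: ds)).
Proof.
elim: bs ds a c b => [|e bs IH] [|f ds] a c b //= sz b0 ac H.
  by case: ifPn => // /eqP ->; rewrite invr0 mulr0.
have /= efP := H 0%N isT.
exists (fun x => lexratio (a + e * x :: bs) (c + f * x :: ds)).
  move=> x xb; have [x0 xb'] := andP xb.
  have y01 : 0 <= x / b <= 1 by rewrite ler_pdivlMr// ler_pdivrMr// mul0r mul1r !ltW.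
  have b1 : b != 0 by rewrite gt_eqF.
  have yE (z : R) : z * x = x / b * (z * b) by field.
  apply: IH.
  - by case: sz.
  - by rewrite subr_gt0.
  - by rewrite !yE; exact: convex_between.
  - move=> i ib; have /= := H i.+1 ib.
    move=> H'; have E z u v : z + u * x + v * (b - x) =
        (z + v * b) + x / b * (u * b - v * b) by field.
    have E2 (z w q : R) : z + q + (w - q) = z + w by ring.
    by rewrite (E a e) (E c f); apply: convex_between; rewrite ?E2.
have [c0|c0] := eqVneq c 0.
  have a0 : a = 0 by lra.
  rewrite c0 a0 !add0r in H efP *.
  apply: cvg_near_cst => /=; near=> x; have x0 : 0 < x by [].
  rewrite !add0r mulf_eq0 (gt_eqF x0) orbF; case: eqVneq => // f0.
  by field; rewrite f0 gt_eqF.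
have H1 : (a + e * x) / (c + f * x) @[x --> 0^'+] --> a / c.
  by apply: cvgM; [exact: cvg_affine_right|apply: cvgV => //; exact: cvg_affine_right].
apply: cvg_trans H1; apply: near_eq_cvg; near=> x; rewrite /= ifF//.
apply/negbTE; rewrite gt_eqF//; near: x.
by apply: (cvgr_gt _ (@cvg_affine_right R c f)); rewrite lt_def c0; lra.
Unshelve. all: by end_near. Qed.

(** Coefficients of sum_a c_a rho_a in the variables rho_1, ..., rho_m, after
    rho_0 = 1 - rho_1 - ... - rho_m has been eliminated. *)
Definition rho_coefs (R : realType) (m : nat) (c : 'I_m.+1 -> R) : seq R :=
  c ord0 :: [seq c (lift ord0 l) - c ord0 | l <- enum 'I_m].

Lemma size_rho_coefs (R : realType) (m : nat) (c : 'I_m.+1 -> R) :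
  size (rho_coefs c) = m.+1.
Proof. by rewrite /= size_map size_enum_ord. Qed.

Lemma nth_rho_coefs (R : realType) (m : nat) (c : 'I_m.+1 -> R) (a : 'I_m.+1) :
  (rho_coefs c)`_a = c a - (a != ord0)%:R * c ord0.
Proof.
case: (unliftP ord0 a) => [l ->|->]; last by rewrite eqxx mul0r subr0.
rewrite eq_sym neq_lift /=.
by rewrite mul1r (nth_map l) ?size_enum_ord ?ltn_ord//= nth_ord_enum.
Qed.

Lemma sum_rho_of_seq (R : realType) (m : nat) (c : 'I_m.+1 -> R) (s : seq R) :
  size s = m ->
  \sum_a c a * rho_of_seq s a = aff (c ord0) (behead (rho_coefs c)) s.
Proof.
move=> sz; rewrite affE; last by have := size_rho_coefs c; rewrite /= sz => -[->].
rewrite big_ord_recl /rho_of_seq /= mulrBr mulr1 (big_nth 0) big_mkord sz mulr_sumr.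
rewrite -addrA -sumrN; congr (_ + _); rewrite -big_split; apply: eq_bigr => l _ /=.
by rewrite (nth_map l) ?size_enum_ord// nth_ord_enum; ring.
Qed.

Lemma iterlim_to_le0 (R : realType) (m : nat) (c : 'I_m.+1 -> R) :
  iterlim_to m 1 (fun s => (\sum_a c a * rho_of_seq s a <= 0)%R%:R)
    (lexneg (rho_coefs c))%:R.
Proof.
have H := @iterlim_to_lexneg R (behead (rho_coefs c)) (c ord0) 1.
have sz : size (behead (rho_coefs c)) = m by rewrite size_behead size_rho_coefs.
rewrite sz in H.
apply: eq_iterlim_to H => // s [ss _ _].
by rewrite sum_rho_of_seq.
Qed.

Lemma lexneg_lead (R : realType) (s : seq R) (i : nat) : (i < size s)%N ->
  s`_i != 0 -> (forall a, (a < i)%N -> s`_a = 0) -> lexneg s = (s`_i < 0).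
Proof.
elim: s i => [|x s IH] [|i] //= lt i0 H.
  by rewrite (negbTE i0) orbF.
have /= -> := H 0%N isT; rewrite ltxx eqxx /=; apply: IH => // a ai.
exact: (H a.+1).
Qed.

(** Eliminating rho_0 changes the later coefficients by c_0 only; if c_0 is not itself
    the leading coefficient it is zero. *)
Lemma lexneg_rho_coefs (R : realType) (m : nat) (c : 'I_m.+1 -> R) (i : 'I_m.+1) :
  c i != 0 -> (forall a : 'I_m.+1, (a < i)%N -> c a = 0) ->
  lexneg (rho_coefs c) = (c i < 0).
Proof.
move=> ci H.
have E (a : 'I_m.+1) : (a <= i)%N -> (rho_coefs c)`_a = c a.
  move=> ai; rewrite nth_rho_coefs; have [->|a0] := eqVneq a ord0.
    by rewrite mul0r subr0.
  by rewrite (H ord0) ?mulr0 ?subr0// (leq_trans _ ai)// lt0n.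
rewrite (@lexneg_lead _ _ i) ?size_rho_coefs ?E// => a ai.
by have := E (Ordinal (ltn_trans ai (ltn_ord i))) (ltnW ai) => /= ->; exact: H.
Qed.

Lemma iterlim_to_ratio (R : realType) (m : nat) (c d : 'I_m.+1 -> R) :
  (forall a, 0 <= c a <= d a) ->
  iterlim_to m 1
    (fun s => (\sum_a c a * rho_of_seq s a) / (\sum_a d a * rho_of_seq s a))
    (lexratio (rho_coefs c) (rho_coefs d)).
Proof.
move=> cd.
have sz (e : 'I_m.+1 -> R) : size (behead (rho_coefs e)) = m.
  by rewrite size_behead size_rho_coefs.
have := @iterlim_to_lexratio R (behead (rho_coefs c)) (behead (rho_coefs d))
  (c ord0) (d ord0) 1.
rewrite !sz => /(_ erefl ltr01 (cd ord0)) H.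
apply: eq_iterlim_to (H _) => //; first by move=> s [ss _ _]; rewrite !sum_rho_of_seq.
move=> i im; have := cd (lift ord0 (Ordinal im)).
have E e := nth_rho_coefs e (lift ord0 (Ordinal im)).
by rewrite !nth_behead !E !mulr1 !mul1r !(addrC (_ ord0)) !subrK.
Qed.

Lemma lexratio_eq0 (R : realType) (s t : seq R) (i : nat) :
  t`_i != 0 -> (forall a, (a <= i)%N -> s`_a = 0) -> lexratio s t = 0.
Proof.
elim: s t i => [|x s IH] [|y t] i //= ti H.
have /= x0 := H 0%N isT; case: ifPn => [/eqP y0|_]; last by rewrite x0 mul0r.
case: i ti H => [|i] /= ti H; first by rewrite y0 eqxx in ti.
by apply: IH ti _ => a ai; exact: (H a.+1).
Qed.

(** The leading term of the denominator comes before that of the numerator, so the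
    quotient is infinitesimal. *)
Lemma lexratio_rho_coefs (R : realType) (m : nat) (c d : 'I_m.+1 -> R) (i : 'I_m.+1) :
  d i != 0 -> (forall a : 'I_m.+1, (a <= i)%N -> c a = 0) ->
  lexratio (rho_coefs c) (rho_coefs d) = 0.
Proof.
move=> di H.
have c0 : c ord0 = 0 by exact: H.
have [d0|d0] := eqVneq (d ord0) 0; last first.
  by rewrite /= (negbTE d0) c0 mul0r.
apply: (@lexratio_eq0 _ _ _ i); first by rewrite nth_rho_coefs d0 mulr0 subr0.
move=> a ai.
have := nth_rho_coefs c (Ordinal (leq_ltn_trans ai (ltn_ord i))) => /= ->.
by rewrite c0 mulr0 subr0; exact: H.
Qed.

(** * Dirichlet integrals over products of simplices *)

Lemma poly_FTC (R : realType) (p : {poly R}) (a b : R) : a < b ->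
  (\int[lebesgue_measure]_(x in `[a, b]) ((deriv p).[x])%:E = (p.[b] - p.[a])%:E)%E.
Proof.
move=> ab; rewrite (@continuous_FTC2 _ _ (horner p))//.
- by apply: continuous_subspaceT => x; exact: continuous_horner.
- split.
  + by move=> x _; exact: derivable_horner.
  + by apply: cvg_at_right_filter; exact: continuous_horner.
  + by apply: cvg_at_left_filter; exact: continuous_horner.
- by move=> x _; rewrite derivE.
Qed.

(** A polynomial primitive of x^p (b - x)^q, found by lowering q with integration by
    parts. *)
Lemma beta_primitive (R : realType) (b : R) (p q : nat) :
  exists P : {poly R}, [/\ deriv P = 'X^p * (b%:P - 'X)^+q, P.[0] = 0 &
    P.[b] = p`!%:R * q`!%:R / (p + q).+1`!%:R * b ^+ (p + q).+1].
Proof.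
elim: q p => [|q IH] p.
  exists (p.+1%:R^-1 *: 'X^(p.+1)); split.
  - rewrite derivZ derivXn -[X in _ *: X]scaler_nat scalerA mulVf ?pnatr_eq0//.
    by rewrite expr0 mulr1 scale1r.
  - by rewrite !hornerE expr0n mulr0.
  - have f0 : p`!%:R != 0 :> R by rewrite pnatr_eq0 -lt0n fact_gt0.
    by rewrite addn0 fact0 mulr1 factS natrM invfM mulrCA mulfV ?mulr1 ?hornerE.
have [P [dP P0 Pb]] := IH p.+1.
exists (p.+1%:R^-1 *: ('X^(p.+1) * (b%:P - 'X)^+q.+1 + q.+1%:R *: P)); split.
- rewrite derivZ derivD derivM derivXn derivZ dP deriv_exp.
  rewrite derivB derivC derivX sub0r /=.
  rewrite -['X^_ *+ _]scaler_nat -[-1 * _ *+ _]scaler_nat -!mul_polyC /= !exprS.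
  have key (A : comRingType) (u v X x y Q e : A) : u * v = 1 ->
      u * (v * x * (y * Q) + X * x * (e * (-1 * Q)) + e * (X * x * Q)) = x * (y * Q).
    by move=> uv; transitivity ((u * v) * (x * (y * Q))); [ring|rewrite uv mul1r].
  by apply: key; rewrite -polyCM mulVf// pnatr_eq0.
- by rewrite !hornerE P0 expr0n/= ?mul0r ?mulr0 ?addr0 ?mulr0.
- have E0 : ('X^(p.+1) * (b%:P - 'X) ^+ q.+1).[b] = 0.
    by rewrite hornerM !horner_exp hornerD hornerN hornerC hornerX subrr expr0n/= mulr0.
  rewrite hornerZ hornerD E0 add0r hornerZ Pb.
  rewrite addSn -addnS (factS p) (factS q) !natrM.
  rewrite !mulrA; congr (_ * _ * _).
  have p0 : p.+1%:R != 0 :> R by rewrite pnatr_eq0.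
  by apply: (mulfI p0); rewrite !mulrA mulfV// mul1r; ring.
Qed.

Lemma beta_integral (R : realType) (b : R) (p q : nat) : 0 < b ->
  (\int[lebesgue_measure]_(x in `[0%R, b]) (x ^+ p * (b - x) ^+ q)%:E =
   (p`!%:R * q`!%:R / (p + q).+1`!%:R * b ^+ (p + q).+1)%:E)%E.
Proof.
move=> b0; have [P [dP P0 Pb]] := beta_primitive b p q.
have := poly_FTC P b0; rewrite P0 subr0 Pb => <-; apply: eq_integral => x _.
by rewrite dP hornerM !horner_exp hornerD hornerN hornerC hornerX.
Qed.

(** The density of a product of Dirichlet integrals, on corner simplices, one coordinate
    at a time. A letter inl e' stands for a coordinate x with factor x^e' and leaves
    b - x for the rest of its block; a letter inr e' closes a block, with the factor
    b^e of its slack b, and opens a new one of size 1 and slack exponent e'. The boolean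
    c selects the closed or the open simplices. *)
Fixpoint dirichlet (R : realType) (c : bool) (b : R) (e : nat)
    (w : seq (nat + nat)) (u : nat -> R) : R :=
  match w with
  | [::] => b ^+ e
  | inr e' :: w' => b ^+ e * dirichlet c 1 e' w' u
  | inl e' :: w' =>
      (u 0 \in Interval (BSide c 0) (BSide (~~ c) b))%:R * u 0%N ^+ e'
      * dirichlet c (b - u 0) e w' (fun i => u i.+1)
  end.

(** The integral of [dirichlet] over the coordinates of w is homogeneous in the size b of
    the first block; this is its degree, and [dir_const] its coefficient. *)
Fixpoint dir_deg (e : nat) (w : seq (nat + nat)) : nat :=
  match w with
  | inl e' :: w' => (e' + dir_deg e w').+1
  | _ => e
  end.

Fixpoint dir_const (R : realType) (e : nat) (w : seq (nat + nat)) : R :=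
  match w with
  | [::] => 1
  | inr e' :: w' => dir_const R e' w'
  | inl e' :: w' =>
      dir_const R e w' * (e'`!%:R * (dir_deg e w')`!%:R / (dir_deg e (inl e' :: w'))`!%:R)
  end.

Definition dir_dim (w : seq (nat + nat)) : nat :=
  count (fun x => if x is inl _ then true else false) w.

Lemma measurable_dirichlet (R : realType) (c : bool) (e : nat) w d
    (T : measurableType d) (b : T -> R) (u : T -> nat -> R) :
  measurable_fun [set: T] b -> (forall i, measurable_fun [set: T] (u ^~ i)) ->
  measurable_fun [set: T] (fun z => dirichlet c (b z) e w (u z)).
Proof.
elim: w e b u => [|[e'|e'] w IH] e b u mb mu /=.
- exact: measurable_funX.
- apply: measurable_funM; last first.
    by apply: IH => //; exact: measurable_funB.
  apply: measurable_funM; last exact: measurable_funX.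
  rewrite (_ : (fun _ => _) = (fun z => ((if c then 0 <= u z 0 else 0 < u z 0) &&
      (if c then u z 0 <= b z else u z 0 < b z) : bool)%:R)); last first.
    by apply/funext => z; rewrite in_itv /=; case: (c).
  have mR : measurable_fun [set: bool] (fun x : bool => x%:R : R) by [].
  apply: (measurableT_comp mR); apply: measurable_and.
    by clear IH; case: c; [exact: measurable_fun_ler|exact: measurable_fun_ltr].
  by clear IH; case: c; [exact: measurable_fun_ler|exact: measurable_fun_ltr].
- by apply: measurable_funM; [exact: measurable_funX|exact: IH].
Qed.

Lemma measurable_nth_tuple (R : realType) (n i : nat) :
  measurable_fun [set: n.-tuple (measurableTypeR R)] (fun t => nth 0 t i).
Proof.
have [lt|ge] := ltnP i n.
  rewrite (_ : (fun _ => _) = (@tnth n (measurableTypeR R) ^~ (Ordinal lt))).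
    exact: measurable_tnth.
  by apply/funext => t; rewrite (tnth_nth 0).
by rewrite (_ : (fun _ => _) = cst 0)//; apply/funext => t; rewrite nth_default ?size_tuple.
Qed.

Lemma measurable_dirichlet_tuple (R : realType) n c (b : R) e w :
  measurable_fun [set: n.-tuple (measurableTypeR R)]
    (fun t => (dirichlet c b e w (nth 0 t))%:E).
Proof.
apply/measurable_EFinP.
have := @measurable_dirichlet R c e w _ (n.-tuple (measurableTypeR R)) (cst b)
  (fun t => nth (0 : R) t).
apply => //; exact: measurable_nth_tuple.
Qed.

Lemma dirichlet_ge0 (R : realType) c (b : R) e w u : 0 <= b -> 0 <= dirichlet c b e w u.
Proof.
elim: w b e u => [|[e'|e'] w IH] b e u b0 /=.
- exact: exprn_ge0.
- case: (boolP (_ \in _)); last by rewrite !mul0r.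
  rewrite in_itv /= => H.
  have /andP[u0 ub] : 0 <= u 0%N <= b.
    by move: H; case: (c) => //= /andP[/ltW -> /ltW ->].
  by rewrite mul1r mulr_ge0 ?exprn_ge0// IH// subr_ge0.
- by rewrite mulr_ge0 ?exprn_ge0// IH.
Qed.

Lemma dir_const_ge0 (R : realType) e w : 0 <= dir_const R e w.
Proof.
elim: w e => [|[e'|e'] w IH] e //=.
by rewrite mulr_ge0// divr_ge0// mulr_ge0.
Qed.

Lemma integral_lebesgue_cons (R : realType) (d : nat)
    (f : d.+1.-tuple (measurableTypeR R) -> \bar R) :
  measurable_fun setT f -> (forall t, 0 <= f t)%E ->
  (\int[lebesgue_tuple R d.+1]_t f t =
   \int[lebesgue_measure]_x \int[lebesgue_tuple R d]_t f (tuple_cons (x, t)))%E.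
Proof.
move=> mf f0.
rewrite [LHS](_ : _ = \int[pushforward (lebesgue_measure \x lebesgue_tuple R d)%E (@tuple_cons R d)]_t f t)%E//.
rewrite ge0_integral_pushforward//; last exact: measurable_tuple_cons.
rewrite preimage_setT fubini_tonelli1//; last by move=> x; exact: f0.
by apply: measurableT_comp => //; exact: measurable_tuple_cons.
Qed.

(** Tonelli, one coordinate at a time: the inner integral is a multiple of a power of
    b - x, so each step is a beta integral. Closed and open simplices give the same
    value, which makes their difference a null set. *)
Lemma integral_dirichlet (R : realType) (c : bool) (w : seq (nat + nat)) (d : nat)
    (b : R) (e : nat) : 0 < b -> d = dir_dim w ->
  (\int[lebesgue_tuple R d]_t (dirichlet c b e w (nth 0%R t))%:E
   = (dir_const R e w * b ^+ dir_deg e w)%:E)%E.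
Proof.
elim: w d b e => [|[e'|e'] w IH] d b e b0 dE.
- by rewrite dE /= integral_dirac// diracT mul1e mul1r.
- have {}dE : d = (dir_dim w).+1 by rewrite dE.
  subst d.
  have mD n w' := @measurable_dirichlet_tuple R n c b e w'.
  rewrite integral_lebesgue_cons; [|exact: mD|]; last first.
    by move=> t; rewrite lee_fin; apply: dirichlet_ge0; exact: ltW.
  pose I := [set` Interval (BSide c 0) (BSide (~~ c) b)].
  have mF : measurable_fun setT (fun x : measurableTypeR R => (\int[lebesgue_tuple R (dir_dim w)]_t
      (dirichlet c b e (inl e' :: w) (nth 0%R (tuple_cons (x, t))))%:E)%E).
    apply: (@measurable_fun_fubini_tonelli_F _ _ _ _ _ (lebesgue_tuple R (dir_dim w))
       (fun p => (dirichlet c b e (inl e' :: w) (nth 0%R (tuple_cons p)))%:E)).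
      by apply: (measurableT_comp (mD _ _)); exact: measurable_tuple_cons.
    by move=> p; rewrite lee_fin; apply: dirichlet_ge0; exact: ltW.
  rewrite [LHS](_ : _ = \int[lebesgue_measure]_(x in I) (\int[lebesgue_tuple R (dir_dim w)]_t
      (dirichlet c b e (inl e' :: w) (nth 0%R (tuple_cons (x, t))))%:E))%E; last first.
    rewrite [RHS]integral_mkcond; apply: eq_integral => x _.
    rewrite patchE; case: ifPn => //; rewrite /I notin_setE /= => /negP/negbTE xI.
    by under eq_integral do rewrite xI !mul0r; rewrite integral0.
  (* at the end point x = b of a closed block the induction hypothesis does not apply *)
  rewrite integral_itv_bndoo; last exact: measurable_funTS.
  rewrite [LHS](_ : _ = \int[lebesgue_measure]_(x in `]0%R, b[)
      ((dir_const R e w)%:E * (x ^+ e' * (b - x) ^+ dir_deg e w)%:E))%E; last first.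
    apply: eq_integral => x; rewrite inE /= in_itv /= => /andP[x0 xb].
    rewrite (_ : (x \in _) = true); last by rewrite in_itv /=; case: (c); rewrite /= ?x0 ?xb ?ltW.
    under eq_integral do rewrite EFinM.
    rewrite ge0_integralZl//=.
    - rewrite (IH _ (b - x)) ?subr_gt0//.
      by rewrite -!EFinM mulrA mulrCA mul1r !mulrA.
    - exact: measurable_dirichlet_tuple.
    - by move=> t _; rewrite lee_fin dirichlet_ge0// subr_ge0 ltW.
    - by rewrite lee_fin mulr_ge0// exprn_ge0// ltW.
  rewrite ge0_integralZl//=; first last.
  + by rewrite lee_fin dir_const_ge0.
  + move=> x; rewrite /= in_itv /= => /andP[x0 xb].
    by rewrite lee_fin mulr_ge0// exprn_ge0// ?subr_ge0 ltW.
  + apply: measurable_funTS; apply/measurable_EFinP.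
    apply: measurable_funM; first exact: measurable_funX.
    by apply: measurable_funX; exact: measurable_funB.
  + rewrite -(@integral_itv_bndoo _ _ _ _ true false); last first.
      apply: measurable_funTS; apply/measurable_EFinP.
      apply: measurable_funM; first exact: measurable_funX.
      by apply: measurable_funX; exact: measurable_funB.
    by rewrite beta_integral// -EFinM mulrA.
- rewrite /= in dE *.
  under eq_integral do rewrite EFinM.
  rewrite ge0_integralZl//=.
  + by rewrite IH// expr1n -EFinM mulr1 mulrC.
  + exact: measurable_dirichlet_tuple.
  + by move=> t _; rewrite lee_fin dirichlet_ge0.
  + by rewrite lee_fin exprn_ge0// ltW.
Qed.

(** * Determinants with one block of rows per part *)

(** Unless both matrices are singular, one is the product of a block unitriangular matrix
    and the other. This is why the volume form on a product of
    simplices does not depend on the base point. *)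
Lemma det_same_normal (K : fieldType) (p k : nat) (M N : 'M[K]_(p + k))
    (B : 'M[K]_(p + k, p)) :
  dsubmx M = dsubmx N -> M *m B = col_mx 1%:M 0 -> N *m B = col_mx 1%:M 0 ->
  \det M = \det N.
Proof.
move=> dM MB NB.
have key (L L2 : 'M[K]_(p + k)) : dsubmx L = dsubmx L2 -> L *m B = col_mx 1%:M 0 ->
    L2 *m B = col_mx 1%:M 0 -> L2 \in unitmx -> \det L = \det L2.
  move=> dL LB L2B uL2; pose U := L *m invmx L2.
  have UL : L = U *m L2 by rewrite /U -mulmxA mulVmx// mulmx1.
  have lU : lsubmx U = col_mx 1%:M 0.
    rewrite -LB UL -mulmxA L2B -[X in _ = X *m _](hsubmxK U) mul_row_col mulmx1.
    by rewrite mulmx0 addr0.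
  have dU : dsubmx U = row_mx 0 1%:M.
    rewrite /U -mul_dsub_mx dL mul_dsub_mx mulmxV//.
    by rewrite (@scalar_mx_block _ p k) block_mxEv col_mxKd.
  have -> : L = block_mx 1%:M (ursubmx U) 0 1%:M *m L2.
    rewrite [LHS]UL -[U in LHS]submxK.
    rewrite /ulsubmx /dlsubmx /drsubmx -/(ursubmx U) dU.
    rewrite -[usubmx U](hsubmxK) row_mxKl row_mxKl row_mxKr.
    have : usubmx (lsubmx U) = 1%:M by rewrite lU col_mxKu.
    by rewrite /lsubmx; move=> H; congr (block_mx _ _ _ _ *m _); rewrite -H; apply/matrixP => i j; rewrite !mxE.
  by rewrite det_mulmx det_ublock !det1 !mul1r.
have [uN|nN] := boolP (N \in unitmx); first exact: key.
have [uM|nM] := boolP (M \in unitmx); first by rewrite -(key N M).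
move: nM nN; rewrite !unitmxE !unitfE !negbK => /eqP -> /eqP ->//.
Qed.

Section block_matrix.
Variables (K : fieldType) (V : finType) (m k : nat).
Implicit Types (e : 'I_(m.+1 + k) -> V) (pi : V -> 'I_m.+1).

(** The map e orders the columns. With one part, the first row is a point of the affine
    hull of a simplex, and the determinant is its volume form in the frame Y. *)
Definition block_rows e pi (theta : V -> K) (Y : 'I_k -> V -> K) : 'M[K]_(m.+1 + k) :=
  col_mx (\matrix_(j, b) ((pi (e b) == j)%:R * theta (e b)))
         (\matrix_(c, b) Y c (e b)).

(** Multiplication by the incidence matrix of elements and parts sums the columns of each
    part: the theta-rows become an identity matrix and the tangent rows vanish. *)
Lemma det_block_rows_normal e pi theta theta' Y : bijective e ->
  (forall j, \sum_(i | pi i == j) theta i = 1) ->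
  (forall j, \sum_(i | pi i == j) theta' i = 1) ->
  (forall c j, \sum_(i | pi i == j) Y c i = 0) ->
  \det (block_rows e pi theta Y) = \det (block_rows e pi theta' Y).
Proof.
move=> be th th' tY; pose B : 'M[K]_(m.+1 + k, m.+1) := \matrix_(b, j) (pi (e b) == j)%:R.
have sumE (f : V -> K) j : \sum_b f (e b) * (pi (e b) == j)%:R = \sum_(i | pi i == j) f i.
  rewrite (reindex e) /=; last exact: onW_bij.
  rewrite [RHS]big_mkcond; apply: eq_bigr => b _.
  by case: ifP => _; rewrite ?mulr1 ?mulr0.
have key t : (forall j, \sum_(i | pi i == j) t i = 1) ->
    block_rows e pi t Y *m B = col_mx 1%:M 0.
  move=> tP; rewrite mul_col_mx; congr col_mx; apply/matrixP => j j'; rewrite !mxE.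
    under eq_bigr do rewrite !mxE.
    rewrite (sumE (fun i => (pi i == j)%:R * t i)) -(tP j').
    have [->|jj'] := eqVneq j j'.
      by rewrite tP; under eq_bigr => i /eqP -> do rewrite eqxx mul1r.
    by apply: big1 => i /eqP ->; rewrite eq_sym (negbTE jj') mul0r.
  by under eq_bigr do rewrite !mxE; rewrite sumE tY.
by apply: (det_same_normal (B := B)); rewrite ?col_mxKd ?key.
Qed.

Lemma det_block_rows_scale e pi (a : V -> K) theta Y : bijective e ->
  \det (block_rows e pi (fun i => a i * theta i) (fun c i => a i * Y c i)) =
  (\prod_i a i) * \det (block_rows e pi theta Y).
Proof.
move=> be; rewrite (_ : block_rows _ _ _ _ =
    block_rows e pi theta Y *m diag_mx (\row_b a (e b))).
  rewrite det_mulmx det_diag mulrC; congr (_ * _).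
  rewrite [RHS](reindex e) /=; last exact: onW_bij.
  by apply: eq_bigr => b _; rewrite !mxE.
rewrite mul_mx_diag; apply/matrixP => x b; rewrite !mxE.
by case: (fintype.split _) => c; rewrite !mxE; ring.
Qed.

(** Subtracting multiples of the first rows from the others; this is the correction term
    in the differential of theta = x / rho. *)
Lemma det_block_rows_reduce e pi theta (C : 'I_k -> 'I_m.+1 -> K) Y :
  \det (block_rows e pi theta (fun c i => Y c i - C c (pi i) * theta i)) =
  \det (block_rows e pi theta Y).
Proof.
rewrite (_ : block_rows _ _ _ _ =
   block_mx 1%:M 0 (- \matrix_(c, j) C c j) 1%:M *m block_rows e pi theta Y).
  by rewrite det_mulmx det_lblock !det1 !mul1r.
rewrite mul_block_col !mul1mx mul0mx addr0; congr col_mx.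
apply/matrixP => c b; rewrite !mxE addrC (bigD1 (pi (e b)))//= big1.
  by rewrite !mxE eqxx mul1r addr0 mulNr.
by move=> j jb; rewrite !mxE eq_sym (negbTE jb) mul0r mulr0.
Qed.

Lemma det_block_rows_dilate e pi (r : 'I_m.+1 -> K) theta Y :
  \det (block_rows e pi (fun i => r (pi i) * theta i) Y) =
  (\prod_j r j) * \det (block_rows e pi theta Y).
Proof.
rewrite (_ : block_rows _ _ _ _ =
   block_mx (diag_mx (\row_j r j)) 0 0 1%:M *m block_rows e pi theta Y).
  rewrite det_mulmx det_lblock !det1 !mulr1 det_diag; congr (_ * _).
  by apply: eq_bigr => j _; rewrite mxE.
rewrite mul_block_col !mul1mx !mul0mx addr0 add0r; congr col_mx.
rewrite mul_diag_mx; apply/matrixP => j b; rewrite !mxE.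
by case: eqP => [<-|]; rewrite ?mul1r// !mul0r mulr0.
Qed.

End block_matrix.

Section frames.
Variables (K : numFieldType) (V : finType) (m k : nat).
Variables (pi : V -> 'I_m.+1) (h : 'I_m.+1 -> V) (t : 'I_k -> V).
Hypothesis pih : forall j, pi (h j) = j.

Definition vertex_of (a : 'I_(m.+1 + k)) : V :=
  match fintype.split a with inl j => h j | inr c => t c end.

(** With the heads of the parts as base point, each tangent row is the indicator of a
    tail element minus one of the first rows, so row operations leave a permutation
    matrix. *)
Lemma block_rows_frame (e : 'I_(m.+1 + k) -> V) :
  \det (block_rows e pi (fun i => (i == h (pi i))%:R : K)
     (fun c i => (i == t c)%:R - (i == h (pi (t c)))%:R)) =
  \det (\matrix_(a, b) (vertex_of a == e b)%:R : 'M[K]_(m.+1 + k)).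
Proof.
rewrite (_ : block_rows _ _ _ _ =
   block_mx 1%:M 0 (- \matrix_(c, j) (pi (t c) == j)%:R) 1%:M *m
   col_mx (\matrix_(j, b) (h j == e b)%:R) (\matrix_(c, b) (t c == e b)%:R)).
  rewrite det_mulmx det_lblock !det1 !mul1r; congr (\det _).
  apply/matrixP => a b; rewrite !mxE /vertex_of.
  by case: (fintype.split _) => c; rewrite !mxE.
rewrite mul_block_col !mul1mx mul0mx addr0; congr col_mx.
  apply/matrixP => j b; rewrite !mxE; case: eqP => [<-|ne]; rewrite ?mul1r ?mul0r 1?eq_sym//.
  by case: eqP => // hb; case: ne; rewrite hb pih.
apply/matrixP => c b; rewrite !mxE addrC (bigD1 (pi (t c)))//= big1.
  by rewrite !mxE eqxx addr0 mulN1r !(eq_sym (e b)).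
by move=> j jc; rewrite !mxE eq_sym (negbTE jc) oppr0 mul0r.
Qed.

Lemma normr_det_vertices (g e : 'I_(m.+1 + k) -> V) : injective g -> bijective e ->
  `|\det (\matrix_(a, b) (g a == e b)%:R : 'M[K]_(m.+1 + k))| = 1.
Proof.
move=> ig [e' ee' e'e].
have ieg : injective (e' \o g) by apply: inj_comp => //; exact: can_inj e'e.
rewrite (_ : \matrix_(_, _) _ = perm_mx (perm ieg)).
  by rewrite det_perm normr_sign.
apply/matrixP => a b; rewrite !mxE permE /=.
by rewrite -(can_eq ee') e'e.
Qed.

End frames.

(** * Products of corner simplices *)

Section dirichlet_words.
Variable R : realType.
Implicit Types (c : bool) (b : R) (u : seq R).

Definition in_corner c b u : bool :=
  all (fun x => if c then 0 <= x else 0 < x) u &&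
  (if c then \sum_(x <- u) x <= b else \sum_(x <- u) x < b).

(** The letters of one block produce the indicator of its corner simplex and a monomial,
    and leave the slack of the block as size for the rest of the word. *)
Lemma dirichlet_cat c b e es w u : (if c then 0 <= b else 0 < b) ->
  (size es <= size u)%N ->
  dirichlet c b e ([seq inl i | i <- es] ++ w) (nth 0 u) =
  (in_corner c b (take (size es) u))%:R * (\prod_(i < size es) u`_i ^+ nth 0%N es i) *
  dirichlet c (b - \sum_(x <- take (size es) u) x) e w (nth 0 (drop (size es) u)).
Proof.
elim: es b u => [|i es IH] b u b0 su.
  rewrite take0 drop0 big_ord0 /= big_nil subr0 mulr1 /in_corner /= big_nil.
  by case: c b0 => ->; rewrite mul1r.
case: u su => [//|x u] /= su.
rewrite big_ord_recl /= (_ : (fun i => u`_i) = nth 0 u); last exact/funext.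
rewrite in_itv /in_corner /= big_cons.
set P := (_ && _).
set Q := (X in _ = (nat_of_bool X)%:R * _ * _).
have [HP|HP] := boolP P; last first.
  rewrite !mul0r; suff -> : Q = false by rewrite !mul0r.
  apply/negbTE; apply: contra HP; rewrite /Q /P.
  by clear -c; case: (c) => /= /andP[/andP[-> /allP H] K] /=;
    [apply: le_trans K; rewrite lerDl|apply: le_lt_trans K; rewrite lerDl];
    rewrite big_seq; apply: sumr_ge0 => y /H // /ltW.
rewrite mul1r IH//; last first.
  by move: HP; rewrite /P; case: (c) => /= /andP[_]; rewrite ?subr_ge0 ?subr_gt0.
suff -> : Q = in_corner c (b - x) (take (size es) u).
  by rewrite opprD addrA; ring.
rewrite /Q /in_corner; move: HP; rewrite /P.
by case: (c) => /= /andP[-> _] /=; rewrite addrC ?lerBrDr ?ltrBrDr.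
Qed.

Lemma dir_deg_cat e es w : dir_deg e w = e ->
  dir_deg e ([seq inl i | i <- es] ++ w) = (e + \sum_(i <- es) i + size es)%N.
Proof.
move=> ew; elim: es => [|i es IH] /=; first by rewrite big_nil ew !addn0.
by rewrite IH big_cons; lia.
Qed.

Lemma dir_const_cat e es w : dir_deg e w = e ->
  dir_const R e ([seq inl i | i <- es] ++ w) =
  dir_const R e w * (e`!%:R * \prod_(i <- es) i`!%:R /
    (e + \sum_(i <- es) i + size es)`!%:R).
Proof.
have f0 n : n`!%:R != 0 :> R by rewrite pnatr_eq0 -lt0n fact_gt0.
move=> ew; elim: es => [|i es IH] /=.
  by rewrite !big_nil !addn0 mulr1 divff// mulr1.
rewrite IH dir_deg_cat// !big_cons addnS addnCA !addnA -!mulrA; congr (_ * _).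
set d := (\sum_(j <- es) j)%N; set p := \prod_(j <- es) _.
have -> : (e + d + i + size es = e + i + d + size es)%N by lia.
move: (f0 (e + d + size es)%N) (f0 (e + i + d + size es).+1%N).
move: ((e + d + size es)`!%:R : R) ((e + i + d + size es).+1`!%:R : R) => q r q0 r0.
by field; rewrite q0 r0.
Qed.

(** All exponents 0: the density is the indicator of a product of corner simplices of
    dimensions ns, and its integral the volume. *)
Definition block_word (ns : seq nat) : seq (nat + nat) :=
  foldr (fun n w => [seq inl i | i <- nseq n 0%N] ++ inr 0%N :: w) [::] ns.

Lemma dir_dim_block_word ns : dir_dim (block_word ns) = sumn ns.
Proof.
elim: ns => [//|n ns IH] /=.
rewrite /dir_dim count_cat /= -/(dir_dim (block_word ns)) IH; congr addn.
by rewrite count_map -[RHS](size_nseq n 0%N); apply/eqP; rewrite -all_count; apply/allP.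
Qed.

Lemma dir_const_block_word ns :
  dir_const R 0 (block_word ns) = \prod_(n <- ns) n`!%:R^-1.
Proof.
elim: ns => [|n ns IH]; first by rewrite big_nil.
rewrite big_cons dir_const_cat//= IH mulrC; congr (_ * _).
rewrite size_nseq add0n fact0 mul1r big1_seq ?mul1r ?big1_seq// => i /=;
  by rewrite mem_nseq => /andP[_ /eqP ->].
Qed.

Fixpoint in_corners c (ns : seq nat) u : bool :=
  if ns is n :: ns' then in_corner c 1 (take n u) && in_corners c ns' (drop n u)
  else true.

Lemma dirichlet_block_word c b ns u : b = 1 \/ ns = [::] ->
  size u = sumn ns ->
  dirichlet c b 0 (block_word ns) (nth 0 u) = (in_corners c ns u)%:R.
Proof.
have c01 : if c then 0 <= 1 :> R else 0 < 1 :> R by case: c.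
elim: ns b u => [|n ns IH] b u; first by rewrite /= expr0.
move=> [->|//] su; rewrite /= dirichlet_cat//=; last by rewrite size_nseq su leq_addr.
rewrite expr0 mul1r size_nseq IH; last 2 first.
- by left.
- by rewrite size_drop su /= addKn.
rewrite big1 ?mulr1; first by rewrite -natrM mulnb.
by move=> i _; rewrite nth_nseq; case: ifP.
Qed.

End dirichlet_words.

(** * Frames and charts of a family of orderings *)

Lemma measurable_chart (R : realType) (I : finType) (ss : seq (seq I)) (d : nat) (i : I) :
  measurable_fun [set: d.-tuple (measurableTypeR R)] (fun u => chart ss u i).
Proof.
apply: measurable_funD => //; apply: measurable_sum => a.
by apply: measurable_funM => //; exact: measurable_tnth.
Qed.

Lemma measurable_chart_region (R : realType) (I : finType) (ss : seq (seq I)) (d : nat)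
    (c : bool) :
  measurable [set u : d.-tuple (measurableTypeR R) |
    forall i, if c then 0 <= chart ss u i else 0 < chart ss u i].
Proof.
rewrite (_ : [set u | _] = \bigcap_(i in [set: I])
    [set u | if c then 0 <= chart ss u i else 0 < chart ss u i]); last first.
  by apply/seteqP; split => u /= H i; [move=> _; exact: H|exact: (H i Logic.I)].
apply: fin_bigcap_measurable; first exact: finite_finset.
move=> i _; have mi := @measurable_chart R I ss d i.
rewrite (_ : [set u | _] = (fun u => chart ss u i) @^-1` [set` Interval (BSide c 0) +oo%O]).
  by rewrite -[_ @^-1` _]setTI; apply: mi => //; exact: measurable_itv.
by apply/seteqP; split => u /=; rewrite in_itv /= andbT; case: c.
Qed.

(** The function hd sends each element to the head of its ordering. The frame vectors are
    the e_x - e_(hd x) for x in the list t of the other elements, in order; so the chart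
    reads off its argument at t and the value at a head is the slack of its block. *)
Section frames_and_charts.
Variables (R : realType) (I : finType) (ss : seq (seq I)) (hd : I -> I).
Let t := flatten [seq behead s | s <- ss].
Hypothesis hd_head : forall s x, s \in ss -> x \in s -> hd x = head x s.
Hypothesis hd_block : forall s x y, s \in ss -> x \in s -> (y \in s) = (hd y == hd x).
Hypothesis ss_cover : forall x, exists2 s, s \in ss & x \in s.
Hypothesis ss_nonempty : [::] \notin ss.
Hypothesis ss_uniq : forall s, s \in ss -> uniq s.
Hypothesis t_uniq : uniq t.

Lemma hd_idem x : hd (hd x) = hd x.
Proof.
have [s sss xs] := ss_cover x; apply/eqP; rewrite -(hd_block _ sss xs).
by rewrite (hd_head sss xs); case: s xs {sss} => [|y s] //= _; rewrite mem_head.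
Qed.

Lemma hd_tail x : x \in t -> hd x != x.
Proof.
move=> /flattenP[_ /mapP[s sss ->]]; case: s sss => [|y s] //= sss xs.
rewrite (hd_head sss); last by rewrite inE xs orbT.
by have /= /andP[+ _] := ss_uniq sss; apply: contraNneq => ->.
Qed.

Lemma mem_heads x : (x \in pmap ohead ss) = (x == hd x).
Proof.
have [s sss xs] := ss_cover x.
rewrite mem_pmap; apply/mapP/eqP => [[s' s'ss]|xE].
  case: s' s'ss => [|y s'] //= s'ss [->].
  by rewrite (hd_head s'ss) ?mem_head.
exists s => //; move: xE; rewrite (hd_head sss xs).
by case: s xs {sss} => [|y s] //= _ ->.
Qed.

Lemma frameE (x0 : I) a : (a < size t)%N ->
  frame R ss a = fun l => (l == nth x0 t a)%:R - (l == hd (nth x0 t a))%:R.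
Proof.
move=> lt; rewrite /frame.
pose G (j l : I) : R := (l == j)%:R - (l == hd j)%:R.
rewrite (_ : flatten _ = [seq G j | j <- t]) ?(nth_map x0)//.
rewrite /t map_flatten -map_comp; congr flatten; apply/eq_in_map => s sss /=.
rewrite /edges; case: s sss => [|y s] //= sss; apply/eq_in_map => j js; apply/funext => l.
by rewrite /G (hd_head sss) ?inE ?js ?orbT.
Qed.

Variable d : nat.
Hypothesis size_t : size t = d.
Implicit Types u : d.-tuple (measurableTypeR R).

Lemma chart_tail u : [seq chart ss u i | i <- t] = u.
Proof.
apply: (@eq_from_nth _ 0); first by rewrite size_map size_tuple.
move=> c; rewrite size_map => lt; have ltd : (c < d)%N by rewrite -size_t.
have x0 : I by case: t lt => [|x ?] // _; exact: x.
have tc : nth x0 t c \in t by exact: mem_nth.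
rewrite (nth_map x0)// /chart mem_heads eq_sym (negbTE (hd_tail tc)) add0r.
rewrite (bigD1 (Ordinal ltd))//= big1 ?addr0 => [|b bc].
  rewrite (frameE x0) // eqxx eq_sym (negbTE (hd_tail tc)) subr0 mulr1.
  by rewrite (tnth_nth 0).
have ltb : (b < size t)%N by rewrite size_t.
rewrite (frameE x0) // nth_uniq// -val_eqE/= in bc *.
rewrite eq_sym (negbTE bc); case: eqP => [E|]; last by rewrite subr0 mulr0.
by have := hd_tail tc; rewrite E hd_idem eqxx.
Qed.

Lemma sum_chart u s : s \in ss -> \sum_(i <- s) chart ss u i = 1.
Proof.
move=> sss.
have [y s' sE] : exists2 y, y \in s & y = hd y.
  case: (s) sss => [|y s'] sss; first by rewrite (negbTE ss_nonempty) in sss.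
  by exists y; rewrite ?mem_head// (hd_head sss) ?mem_head.
rewrite big_split /= exchange_big /= [X in _ + X]big1 => [|a _].
  rewrite addr0 (bigD1_seq y) ?ss_uniq//= mem_heads -sE eqxx big_seq_cond big1 ?addr0//.
  move=> x /andP[xs xy]; rewrite mem_heads.
  have := hd_block x sss s'; rewrite xs -sE => /esym/eqP ->.
  by rewrite (negbTE xy).
have x0 : I by exact: y.
rewrite -mulr_sumr (frameE x0) ?size_t// sumrB.
have count z : \sum_(i <- s) (i == z)%:R = (z \in s)%:R :> R.
  rewrite -natr_sum -(count_uniq_mem z (ss_uniq sss)) -sum1_count [in RHS]big_mkcond.
  by congr _%:R; apply: eq_bigr => i _ /=; case: eqP.
rewrite !count !(hd_block _ sss s') hd_idem subrr mulr0//.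
Qed.

Lemma chart_head u x s : x :: s \in ss ->
  chart ss u x = 1 - \sum_(i <- s) chart ss u i.
Proof. by move=> /(sum_chart u); rewrite big_cons => <-; rewrite addrK. Qed.

Lemma in_corners_flatten c (f : I -> R) (xs : seq (seq I)) :
  in_corners c (map size xs) [seq f i | i <- flatten xs] =
  all (fun x => in_corner c 1 [seq f i | i <- x]) xs.
Proof.
elim: xs => [//|x xs IH] /=.
by rewrite map_cat take_size_cat ?size_map// drop_size_cat ?size_map// IH.
Qed.

Lemma in_corners_chart u (c : bool) :
  in_corners c [seq size (behead s) | s <- ss] u =
  [forall i, if c then 0 <= chart ss u i else 0 < chart ss u i].
Proof.
rewrite -[X in in_corners _ _ X](chart_tail u) /t map_comp in_corners_flatten all_map.
apply/allP/forallP => [H x|H s sss].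
  have [s sss xs] := ss_cover x; have := H s sss.
  case: s sss xs {H} => [|y s] //= sss; rewrite inE => /predU1P[->|xs] /andP[/allP P Q].
    move: Q; rewrite (chart_head u sss) big_map.
    by case: (c); rewrite ?subr_ge0 ?subr_gt0.
  by apply: P; exact: map_f.
rewrite /in_corner /=; case: s sss => [|y s] sss; first by rewrite (negbTE ss_nonempty) in sss.
apply/andP; split; first by apply/allP => _ /mapP[i _ ->]; exact: H.
have := H y; rewrite (chart_head u sss) big_map.
by case: (c); rewrite ?subr_ge0 ?subr_gt0.
Qed.

(** The chart coordinates of each ordering add up to 1 for every u, so positivity alone
    cuts out the region, a product of corner simplices. *)
Lemma lebesgue_tuple_chart (c : bool) :
  lebesgue_tuple R d
    [set u | forall i, if c then 0 <= chart ss u i else 0 < chart ss u i] =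
  (\prod_(s <- ss) (size (behead s))`!%:R^-1)%:E.
Proof.
set A := [set u | _].
have mA : measurable A.
  exact: measurable_chart_region.
have dE : d = dir_dim (block_word [seq size (behead s) | s <- ss]).
  by rewrite dir_dim_block_word -size_t /t size_flatten /shape -map_comp.
rewrite -[A]setIT -integral_indic// -(big_map (fun s => size (behead s)) xpredT
  (fun n => n`!%:R^-1)) -dir_const_block_word.
have := @integral_dirichlet R c (block_word [seq size (behead s) | s <- ss]) d 1 0 ltr01 dE.
rewrite expr1n mulr1 => <-; apply: eq_integral => u _.
rewrite dirichlet_block_word; [|by left|]; last first.
  by rewrite size_tuple dE dir_dim_block_word.
rewrite in_corners_chart indicE; congr (_%:R%:E); congr nat_of_bool.
by apply/idP/forallP; rewrite in_setE.
Qed.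

End frames_and_charts.

(** * Frames and charts of a flag *)

Section flag_charts.
Variables (V : finType) (m k : nat).
Hypothesis cardV : #|V| = (m + k).+1.
Variables (o : {set V} -> seq V) (F : m.+1.-tuple {set V}).
Hypothesis o_perm : forall W, perm_eq (o W) (enum W).
Hypothesis flagF : is_flag F.

Definition flag_base (x : V) : V := head x (o (tnth F (part F x))).
Definition flag_tail : seq V := flatten [seq behead s | s <- map o F].

Lemma mem_order W x : (x \in o W) = (x \in W).
Proof. by rewrite (perm_mem (o_perm W)) mem_enum. Qed.

Lemma mem_flag_order s x : s \in map o F -> x \in s -> s = o (tnth F (part F x)).
Proof.
move=> /mapP[W /tnthP[j ->] ->]; rewrite mem_order -part_flag// => /eqP ->//.
Qed.

Lemma part_base x : part F (flag_base x) = part F x.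
Proof.
apply/eqP; rewrite part_flag// -mem_order /flag_base.
have : x \in o (tnth F (part F x)) by rewrite mem_order -part_flag.
by case: (o _) => //= y s _; rewrite mem_head.
Qed.

Lemma base_head s x : s \in map o F -> x \in s -> flag_base x = head x s.
Proof. by move=> sF xs; rewrite /flag_base -(mem_flag_order sF xs). Qed.

Lemma flag_base_eq x y : (flag_base y == flag_base x) = (part F y == part F x).
Proof.
apply/eqP/eqP => [/(congr1 (part F))|xy]; first by rewrite !part_base.
have : x \in o (tnth F (part F x)) by rewrite mem_order -part_flag.
by rewrite /flag_base xy; case: (o _).
Qed.

Lemma base_block s x y : s \in map o F -> x \in s ->
  (y \in s) = (flag_base y == flag_base x).
Proof.
move=> sF xs; rewrite (mem_flag_order sF xs) mem_order -part_flag//.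
by rewrite flag_base_eq.
Qed.

Lemma flag_cover x : exists2 s, s \in map o F & x \in s.
Proof.
exists (o (tnth F (part F x))); first by rewrite map_f// mem_tnth.
by rewrite mem_order -part_flag.
Qed.

Lemma part_surj (j : 'I_m.+1) : exists x, part F x = j.
Proof.
have : tnth F j != finset.set0.
  move: (flagF) => /andP[_ /and3P[_ _]]; apply: contraNneq => <-.
  by rewrite inE mem_tnth.
by move=> /set0Pn[x xj]; exists x; apply/eqP; rewrite part_flag.
Qed.

Lemma flag_nonempty : [::] \notin map o F.
Proof.
apply/mapP => -[W /tnthP[j ->]] oW; have [x /eqP] := part_surj j.
by rewrite part_flag// -mem_order -oW.
Qed.

Lemma flag_uniq s : s \in map o F -> uniq s.
Proof. by move=> /mapP[W _ ->]; rewrite (perm_uniq (o_perm W)) enum_uniq. Qed.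

Lemma flag_tail_uniq : uniq flag_tail.
Proof.
apply: count_mem_uniq => x; apply/eqP; rewrite eqn_leq andbC.
have le1 : (count_mem x flag_tail <= 1)%N.
  rewrite count_flatten -map_comp sumnE big_map big_map big_tuple.
  apply: (@leq_trans (\sum_(j < m.+1) (part F x == j))).
    apply: leq_sum => j _ /=; rewrite part_flag// -mem_order.
    rewrite -count_uniq_mem ?(perm_uniq (o_perm _)) ?enum_uniq//.
    by case: (o _) => //= y s; rewrite leq_addl.
  by rewrite (bigD1 (part F x))//= eqxx big1// => j; rewrite eq_sym => /negbTE ->.
rewrite -has_pred1 has_count; case: (count_mem _ _) le1 => [|[|]]//.
Qed.

Lemma size_flag_order j : size (o (tnth F j)) = #|tnth F j|.
Proof. by rewrite (perm_size (o_perm _)) cardE. Qed.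

Lemma card_flag_gt0 j : (0 < #|tnth F j|)%N.
Proof. by have [x /eqP] := part_surj j; rewrite part_flag// => xj; apply/card_gt0P; exists x. Qed.

Lemma sum_card_flag : (\sum_j #|tnth F j| = (m + k).+1)%N.
Proof.
rewrite -cardV -sum1_card (partition_big (part F) xpredT)//=.
by apply: eq_bigr => j _; rewrite -sum1_card; apply: eq_bigl => i; rewrite -part_flag.
Qed.

Lemma size_flag_tail : size flag_tail = k.
Proof.
rewrite size_flatten /shape sumnE -2!map_comp big_map big_tuple.
apply: (@addnI m.+1); rewrite [RHS]addSn -sum_card_flag -{1}(card_ord m.+1) -sum1_card -big_split.
by apply: eq_bigr => j _ /=; rewrite size_behead size_flag_order add1n prednK// card_flag_gt0.
Qed.

Variable x0 : V.
Definition flag_head (j : 'I_m.+1) : V := head x0 (o (tnth F j)).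
Definition flag_tnth (c : 'I_k) : V := nth x0 flag_tail c.

Lemma flag_headE x : flag_base x = flag_head (part F x).
Proof.
have : x \in o (tnth F (part F x)) by rewrite mem_order -part_flag.
by rewrite /flag_base /flag_head; case: (o _).
Qed.

Lemma part_head j : part F (flag_head j) = j.
Proof. by have [x <-] := part_surj j; rewrite -flag_headE part_base. Qed.

Lemma flag_vertex_inj : injective (vertex_of flag_head flag_tnth).
Proof.
have ht j c : flag_head j <> flag_tnth c.
  move=> E; have := hd_tail base_head flag_uniq (x := flag_tnth c).
  rewrite mem_nth ?size_flag_tail// => /(_ isT).
  by rewrite -E flag_headE part_head eqxx.
move=> a b; rewrite /vertex_of -{2}(splitK a) -{2}(splitK b).
case: (fintype.split a) => i; case: (fintype.split b) => j.
- by move=> /(congr1 (part F)); rewrite !part_head => ->.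
- by move=> /ht.
- by move=> /esym/ht.
- move/eqP; rewrite nth_uniq ?size_flag_tail ?flag_tail_uniq// => /eqP ij.
  by congr unsplit; congr inr; exact: val_inj.
Qed.

Variable R : realType.

Lemma flag_frameE (c : 'I_k) : frame R (map o F) c =
  fun i => (i == flag_tnth c)%:R - (i == flag_head (part F (flag_tnth c)))%:R.
Proof.
rewrite (frameE R base_head x0) -/flag_tail ?size_flag_tail//.
by rewrite -/(flag_tnth c) flag_headE.
Qed.

Definition flag_vol : R := \prod_j (#|tnth F j|.-1)`!%:R^-1.

Lemma lebesgue_flag_chart (c : bool) :
  lebesgue_tuple R k [set u | forall i, if c then 0 <= chart (map o F) u i
                                        else 0 < chart (map o F) u i] = flag_vol%:E.
Proof.
have := lebesgue_tuple_chart R base_head base_block flag_cover flag_nonempty flag_uniq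
  flag_tail_uniq size_flag_tail c.
move=> ->; rewrite big_map big_tuple; congr (_%:E); apply: eq_bigr => j _.
by rewrite size_behead size_flag_order.
Qed.

Lemma sum_flag_chart (u : k.-tuple (measurableTypeR R)) j :
  \sum_(i in tnth F j) chart (map o F) u i = 1.
Proof.
have oF : o (tnth F j) \in map o F by rewrite map_f// mem_tnth.
have := sum_chart base_head base_block flag_cover flag_nonempty flag_uniq
  size_flag_tail u oF.
by rewrite (perm_big _ (o_perm _)) big_enum_cond /=; under eq_bigl do rewrite andbT.
Qed.

Lemma chart_open_simplices :
  @chart R V (map o F) k @^-1` open_simplices F =
  [set u : k.-tuple (measurableTypeR R) | forall i, 0 < chart (map o F) u i].
Proof.
apply/seteqP; split => u /=; first by case.
by move=> H; split => // W /tnthP[j ->]; rewrite sum_flag_chart.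
Qed.

Lemma chart_simplices :
  @chart R V (map o F) k @^-1` simplices F =
  [set u : k.-tuple (measurableTypeR R) | forall i, 0 <= chart (map o F) u i].
Proof.
apply/seteqP; split => u /=; first by case.
by move=> H; split => // W /tnthP[j ->]; rewrite sum_flag_chart.
Qed.

End flag_charts.

(** * A single simplex as a flag with one part *)

(** Results on T and R are obtained from those on Theta for the flag with the single
    part V. *)
Lemma is_flag_single (V : finType) (x0 : V) : is_flag [tuple [set: V]%SET].
Proof.
rewrite /is_flag /=; apply/and3P; split.
- rewrite /finset.cover; apply/eqP/setP => x; rewrite inE; apply/bigcupP.
  by exists [set: V]%SET; rewrite inE ?mem_head.
- apply/finset.trivIsetP => A B; rewrite !inE => /eqP -> /eqP ->.
  by rewrite eqxx.
- rewrite inE inE; apply/eqP => /setP/(_ x0); by rewrite !inE.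
Qed.

Lemma part_single (V : finType) : part [tuple [set: V]%SET] = fun=> ord0.
Proof. by apply/funext => x; rewrite [LHS]ord1. Qed.

Section simplex.
Variables (I : finType) (d : nat).
Hypothesis cardI : #|I| = d.+1.
Variable s : seq I.
Hypothesis s_perm : perm_eq s (enum I).

Let F1 : 1.-tuple {set I} := [tuple [set: I]%SET].
Let o1 (W : {set I}) := if W == [set: I]%SET then s else enum W.

Lemma o1_perm W : perm_eq (o1 W) (enum W).
Proof.
rewrite /o1; case: eqP => // ->; rewrite enum_setT.
by move: s_perm; rewrite /enum_mem filter_predT.
Qed.

Lemma o1_map : map o1 F1 = [:: s].
Proof. by rewrite /= /o1 eqxx. Qed.

Lemma simplex_cons : exists x0 s', s = x0 :: s'.
Proof.
have := perm_size s_perm; rewrite -cardE cardI.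
by case: s => [//|x s'] _; exists x, s'.
Qed.

Variable R : realType.

Lemma lebesgue_simplex_chart (c : bool) :
  lebesgue_tuple R d [set u | forall i, if c then 0 <= chart [:: s] u i
                                        else 0 < chart [:: s] u i] = (d`!%:R^-1)%:E.
Proof.
have [x0 _] := simplex_cons.
have := @lebesgue_flag_chart I 0 d cardI o1 F1 o1_perm (is_flag_single x0) R c.
rewrite o1_map => ->; rewrite /flag_vol big_ord1 (tnth_nth finset.set0) /=.
by rewrite cardsT cardI.
Qed.

Lemma sum_simplex_chart (u : d.-tuple (measurableTypeR R)) :
  \sum_i chart [:: s] u i = 1.
Proof.
have [x0 _] := simplex_cons.
have := @sum_flag_chart I 0 d cardI o1 F1 o1_perm (is_flag_single x0) R u ord0.
by rewrite o1_map (tnth_nth finset.set0) /=; under eq_bigl do rewrite inE.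
Qed.

Lemma chart_simplex :
  @chart R I [:: s] d @^-1` simplices [:: [set: I]%SET] =
  [set u | forall i, 0 <= chart [:: s] u i].
Proof.
have [x0 _] := simplex_cons.
have := @chart_simplices I 0 d cardI o1 F1 o1_perm (is_flag_single x0) R.
by rewrite o1_map.
Qed.

(** A single block: the head coordinate is the slack of the block, so its exponent is the
    slack exponent. *)
Lemma simplex_moment (n : I -> nat) :
  (\int[lebesgue_tuple R d]_(u in [set u | forall i, (0 < chart [:: s] u i)%R])
     (\prod_i chart [:: s] u i ^+ n i)%R%:E =
  ((\prod_i (n i)`!%:R) / (\sum_i n i + d)`!%:R)%R%:E)%E.
Proof.
have [x0 [s' sE]] := simplex_cons.
have fl := is_flag_single x0.
have hb : forall t x, t \in [:: s] -> x \in t -> flag_base o1 F1 x = head x t.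
  by move=> t x; rewrite -o1_map; exact: (base_head o1_perm fl).
have bb : forall t x y, t \in [:: s] -> x \in t ->
    (y \in t) = (flag_base o1 F1 y == flag_base o1 F1 x).
  by move=> t x y; rewrite -o1_map; exact: (base_block o1_perm fl).
have cov : forall x, exists2 t, t \in [:: s] & x \in t.
  by move=> x; rewrite -o1_map; exact: (flag_cover o1_perm fl).
have ne : [::] \notin [:: s] by rewrite -o1_map; exact: (flag_nonempty o1_perm fl).
have us : forall t, t \in [:: s] -> uniq t by rewrite -o1_map; exact: (flag_uniq o1_perm).
have ut : uniq (flatten [seq behead t | t <- [:: s]]).
  by have := @flag_tail_uniq _ _ o1 F1 o1_perm fl; rewrite /flag_tail o1_map.
have st : size (flatten [seq behead t | t <- [:: s]]) = d.
  by have := @size_flag_tail _ 0 d cardI o1 F1 o1_perm fl; rewrite /flag_tail o1_map.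
have big_s (T : Type) (z : T) (op : Monoid.com_law z) (f : I -> T) :
    \big[op/z]_i f i = op (f x0) (\big[op/z]_(i <- s') f i).
  have <- : \big[op/z]_(i <- s) f i = op (f x0) (\big[op/z]_(i <- s') f i) by rewrite sE big_cons.
  by rewrite (perm_big _ s_perm) big_enum.
have szs' : size s' = d by move: st; rewrite sE /= cats0.
pose w : seq (nat + nat) := [seq inl i | i <- map n s'] ++ [::].
have dw : d = dir_dim w.
  rewrite /dir_dim /w cats0 -map_comp count_map -szs' -[LHS](count_predT s').
  by apply: eq_count.
rewrite integral_mkcond.
have := @integral_dirichlet R false w d 1 (n x0) ltr01 dw.
rewrite expr1n mulr1 dir_const_cat// /= mul1r size_map szs' big_map.
rewrite (big_s _ _ _ (fun i => (n i)`!%:R)) (big_s _ _ _ n) /= big_map => <-.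
apply: eq_integral => u _.
have chu : [seq chart [:: s] u i | i <- s'] = u.
  by have := chart_tail hb bb cov us ut st u; rewrite sE /= cats0.
have E : in_corner false 1 u = [forall i, 0 < chart [:: s] u i].
  rewrite -(in_corners_chart hb bb cov ne us ut st u false) /= andbT sE /=.
  by rewrite take_oversize// szs' size_tuple.
rewrite /w dirichlet_cat//; last by rewrite size_map szs' size_tuple.
rewrite /= size_map szs' take_oversize ?size_tuple// E patchE.
have -> : (u \in [set u | forall i, 0 < chart [:: s] u i]) = [forall i, 0 < chart [:: s] u i].
  by apply/idP/forallP; rewrite in_setE.
case: ifP => _; last by rewrite !mul0r.
rewrite mul1r mulrC; congr (_%:E).
rewrite (big_s _ _ _ (fun i => chart [:: s] u i ^+ n i)) /=; congr (_ * _).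
  rewrite (chart_head hb bb cov ne us st u (s := s')) ?sE ?mem_head//.
  by rewrite -sE -chu big_map.
rewrite (big_nth x0) big_mkord szs'; apply: eq_bigr => i _.
by rewrite -chu !(nth_map x0) ?szs'.
Qed.

End simplex.

(** * Volume forms in quasi-cylindrical coordinates *)

Lemma split_ord0 (p k : nat) : fintype.split (ord0 : 'I_(p.+1 + k)) = inl ord0.
Proof. by rewrite -(unsplitK (inl ord0)); congr fintype.split; apply: val_inj. Qed.

Lemma split_lift1 (k : nat) (c : 'I_k) :
  fintype.split (lift ord0 c : 'I_(1 + k)) = inr c.
Proof. by rewrite -(unsplitK (inr c)); congr fintype.split; apply: val_inj. Qed.

Lemma split_lift (p k : nat) (c : 'I_(p + k)) :
  fintype.split (lift ord0 c : 'I_(p.+1 + k)) =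
  match fintype.split c with inl i => inl (lift ord0 i) | inr i => inr i end.
Proof.
case: (fintype.splitP c) => i E.
  rewrite -(unsplitK (inl (lift ord0 i))); congr fintype.split; apply: val_inj.
  by rewrite /= /bump /= E.
rewrite -(unsplitK (inr i)); congr fintype.split; apply: val_inj.
by rewrite /= /bump /= E.
Qed.

Section flag_determinants.
Variables (R : realType) (V : finType) (m k : nat).
Hypothesis cardV : #|V| = (m + k).+1.
Variables (o : {set V} -> seq V) (F : m.+1.-tuple {set V}).
Hypothesis o_perm : forall W, perm_eq (o W) (enum W).
Hypothesis flagF : is_flag F.

Lemma sum_flag_part (f : V -> R) j :
  \sum_(i in tnth F j) f i = \sum_(i | part F i == j) f i.
Proof. by apply: eq_bigl => i; rewrite part_flag. Qed.

Lemma sum_part_base (f : V -> R) (x0 : V) (j : 'I_m.+1) :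
  \sum_(i | part F i == j) (i == flag_head o F x0 (part F i))%:R = 1 :> R.
Proof.
rewrite (bigD1 (flag_head o F x0 j)) ?part_head//= eqxx big1 ?addr0//.
by move=> i /andP[/eqP -> /negbTE ->].
Qed.

Lemma frame_tangent (c : 'I_k) (j : 'I_m.+1) :
  \sum_(i | part F i == j) frame R (map o F) c i = 0.
Proof.
have [x0 _] : exists x0 : V, true.
  by apply/card_gt0P; rewrite cardV.
rewrite (flag_frameE cardV o_perm flagF x0) sumrB.
have count z : \sum_(i | part F i == j) (i == z)%:R = (part F z == j)%:R :> R.
  have [zj|zj] := boolP (part F z == j).
    rewrite (bigD1 z)//= eqxx big1 ?addr0// => i /andP[_ /negbTE ->] //.
  apply: big1 => i /eqP ij; have [E|//] := eqVneq i z.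
  by rewrite -E ij eqxx in zj.
by rewrite !count part_head// subrr.
Qed.

(** The affine charts are unimodular. *)
Lemma normr_det_frame (e : 'I_(m.+1 + k) -> V) (theta : V -> R) : bijective e ->
  (forall j, \sum_(i | part F i == j) theta i = 1) ->
  `|\det (block_rows e (part F) theta (fun c => frame R (map o F) (c : 'I_k)))| = 1.
Proof.
move=> be th; have x0 : V by exact: e ord0.
(* move the base point to the heads of the parts *)
rewrite (det_block_rows_normal (theta' := fun i => (i == flag_head o F x0 (part F i))%:R) be)//.
- rewrite (_ : (fun c : 'I_k => _) =
    fun c i => (i == flag_tnth o F x0 c)%:R - (i == flag_head o F x0 (part F (flag_tnth o F x0 c)))%:R).
    rewrite block_rows_frame; last exact: part_head.
    by apply: normr_det_vertices => //; exact: flag_vertex_inj.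
  by apply/funext => c; rewrite (flag_frameE cardV o_perm flagF x0).
- exact: sum_part_base.
- by move=> c j; exact: frame_tangent.
Qed.

End flag_determinants.

Section volume.
Variables (R : realType) (V : finType) (d : nat).
Hypothesis cardV : #|V| = d.+1.
Variable s : seq V.
Hypothesis s_perm : perm_eq s (enum V).
Variable x0 : V.

Definition nth_order (b : 'I_(1 + d)) : V := nth x0 s b.

Lemma size_order : size s = d.+1.
Proof. by rewrite (perm_size s_perm) -cardE. Qed.

Lemma uniq_order : uniq s.
Proof. by rewrite (perm_uniq s_perm) enum_uniq. Qed.

Lemma nth_order_bij : bijective nth_order.
Proof.
apply: inj_card_bij; last by rewrite cardV card_ord.
move=> a b /eqP; rewrite nth_uniq ?uniq_order ?size_order// => /eqP; exact: val_inj.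
Qed.

(** The first row can be any point w of the affine hull: the unit normal is sqrt(d + 1)
    times the barycentre. *)
Lemma volume_form_det (x : V -> R) (X : 'I_d -> V -> R) (w : V -> R) :
  \sum_i w i = 1 -> (forall c, \sum_i X c i = 0) ->
  volume_form s x X =
  Num.sqrt d.+1%:R * \det (block_rows nth_order (fun=> ord0 : 'I_1) w X).
Proof.
move=> w1 X0.
have all0 (j : 'I_1) (i : V) : ((ord0 : 'I_1) == j) = true by apply/eqP; rewrite [RHS]ord1.
have N0 : d.+1%:R != 0 :> R by rewrite pnatr_eq0.
have sN0 : Num.sqrt (d.+1%:R : R) != 0 by rewrite gt_eqF// sqrtr_gt0 ltr0n.
rewrite (det_block_rows_normal (theta' := fun=> d.+1%:R^-1) nth_order_bij); first last.
- by move=> c j; rewrite -[RHS](X0 c); apply: eq_bigl => i; rewrite all0.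
- move=> j; rewrite (eq_bigl xpredT) => [|i]; last by rewrite all0.
  by rewrite sumr_const cardV -[_^-1 *+ _]mulr_natl mulfV.
- by move=> j; rewrite -[RHS]w1; apply: eq_bigl => i; rewrite all0.
have := det_block_rows_dilate nth_order (fun=> ord0 : 'I_1) (fun=> Num.sqrt d.+1%:R)
  (fun=> d.+1%:R^-1) X.
rewrite big_ord1 => <-; rewrite /volume_form; congr (\det _).
apply/matrixP => a b; rewrite !mxE (nth_map x0) ?size_order//.
have [c ->|->] := unliftP ord0 a.
  by rewrite split_lift1 mxE.
rewrite split_ord0 mxE eqxx mul1r.
by apply: (mulfI sN0); rewrite mulfV// mulrA -expr2 sqr_sqrtr ?ler0n// mulfV.
Qed.

End volume.

Section pullback.
Variables (R : realType) (V : finType) (m k : nat).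
Hypothesis cardV : #|V| = (m + k).+1.
Variables (s : seq V) (F : m.+1.-tuple {set V}) (x0 : V).
Hypothesis s_perm : perm_eq s (enum V).
Let e := nth_order s x0 : 'I_(m.+1 + k) -> V.

(** Scaling the |V_j| columns of the j-th part by r_j also scales the j-th of the first
    rows, which does not carry this factor. *)
Lemma det_part_scale (r : 'I_m.+1 -> R) (theta : V -> R) (Y : 'I_k -> V -> R) :
  is_flag F -> (forall j, r j != 0) ->
  \det (block_rows e (part F) theta (fun c i => r (part F i) * Y c i)) =
  (\prod_j r j ^+ #|tnth F j|.-1) * \det (block_rows e (part F) theta Y).
Proof.
move=> flagF r0.
have be : bijective e by exact: nth_order_bij.
have P0 : \prod_j r j != 0 by apply/prodf_neq0.
apply: (mulfI P0); rewrite mulrA.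
rewrite -det_block_rows_dilate (det_block_rows_scale _ (fun i => r (part F i)) _ _ be).
congr (_ * _); rewrite (partition_big (part F) xpredT)//= -big_split/=.
apply: eq_bigr => j _; rewrite -exprS prednK ?card_flag_gt0//.
rewrite (eq_bigr (fun=> r j)) => [|i /eqP ->//].
by rewrite prodr_const; congr (_ ^+ _); apply: eq_card => i; rewrite -(part_flag i j flagF).
Qed.

Lemma tdiff_Phi (r X : 'I_m.+1 -> R) (theta Y : V -> R) :
  tdiff (Phi F) (r, theta) (X, Y) =
  fun i => X (part F i) * theta i + r (part F i) * Y i.
Proof.
apply/funext => i; rewrite /tdiff /Phi /=.
have D : is_derive (0 : R) (1 : R) (fun t : R => (r (part F i) + t * X (part F i)) * (theta i + t * Y i))
    (X (part F i) * theta i + r (part F i) * Y i).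
  apply: is_derive_eq; rewrite !mul0r !addr0 !scaler0 !add0r /GRing.scale /=.
  ring.
by rewrite derive1E; apply: derive_val.
Qed.

(** With Phi(r, theta) itself as first row, the first m + 1 rows are combinations, with
    coefficients r and X, of the restrictions of theta to the parts. *)
Lemma pullback_volume (r : 'I_m.+1 -> R) (theta : V -> R)
    (X : 'I_m -> 'I_m.+1 -> R) (Y : 'I_k -> V -> R) :
  is_flag F -> \sum_j r j = 1 ->
  (forall j, \sum_(i | part F i == j) theta i = 1) ->
  (forall a, \sum_j X a j = 0) ->
  (forall c j, \sum_(i | part F i == j) Y c i = 0) ->
  pullback (Phi F) (@volume_form R V s (m + k)) (r, theta) (prod_vectors X Y) =
  Num.sqrt (m + k).+1%:R *
  \det (block_rows (id : 'I_(1 + m) -> 'I_m.+1) (fun=> ord0 : 'I_1) r X) *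
  \det (block_rows e (part F) theta (fun c i => r (part F i) * Y c i)).
Proof.
move=> flagF r1 th X0 Y0; rewrite /pullback.
rewrite (_ : (fun a => _) = fun a : 'I_(m + k) => match fintype.split a with
    | inl c => fun i => X c (part F i) * theta i
    | inr c => fun i => r (part F i) * Y c i end); last first.
  apply/funext => a; rewrite /prod_vectors; case: (fintype.split a) => c;
  by rewrite tdiff_Phi; apply/funext => i; rewrite ?mulr0 ?addr0// mul0r add0r.
have sum_part (f : V -> R) : \sum_i f i = \sum_j \sum_(i | part F i == j) f i.
  by rewrite (partition_big (part F) xpredT).
rewrite (@volume_form_det _ _ _ cardV _ s_perm x0 _ _ (fun i => r (part F i) * theta i)); last 2 first.
- rewrite sum_part -[RHS]r1; apply: eq_bigr => j _.
  by under eq_bigr => i /eqP -> do []; rewrite -mulr_sumr th mulr1.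
- move=> a; case: (fintype.split a) => c; rewrite sum_part.
    rewrite -[RHS](X0 c); apply: eq_bigr => j _.
    by under eq_bigr => i /eqP -> do []; rewrite -mulr_sumr th mulr1.
  apply: big1 => j _.
  by under eq_bigr => i /eqP -> do []; rewrite -mulr_sumr Y0 mulr0.
rewrite -mulrA; congr (_ * _).
set A := block_rows (id : 'I_(1 + m) -> 'I_m.+1) (fun=> ord0 : 'I_1) r X.
transitivity (\det (block_mx (A : 'M[R]_(m.+1)) 0 0 1%:M *m
   block_rows e (part F) theta (fun c i => r (part F i) * Y c i))); last first.
  by rewrite det_mulmx det_lblock det1 mulr1.
congr (\det _); rewrite mul_block_col !mul0mx mul1mx addr0 add0r.
apply/matrixP => a b.
rewrite [RHS]mxE.
(* a combination of the theta-rows has one nonzero term in each column *)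
have entry (f : 'I_m.+1 -> R) :
    f (part F (e b)) * theta (e b) = \sum_j f j * ((part F (e b) == j)%:R * theta (e b)).
  rewrite (bigD1 (part F (e b)))//= eqxx mul1r big1 ?addr0// => j.
  by rewrite eq_sym => /negbTE ->; rewrite mul0r mulr0.
have [c ->|->] := unliftP ord0 a; last first.
  rewrite !mxE !split_ord0 !mxE eqxx mul1r entry.
  apply: eq_bigr => j _; rewrite !mxE; congr (_ * _).
  by rewrite split_ord0 mxE eqxx mul1r.
rewrite mxE split_lift1 mxE split_lift.
case: (fintype.split c) => i; last by rewrite mxE.
rewrite mxE entry; apply: eq_bigr => j _; rewrite !mxE; congr (_ * _).
by rewrite split_lift1 mxE.
Qed.

End pullback.

(** * The integral of the volume form *)

Section simplex_frame.
Variables (R : realType) (I : finType) (d : nat).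
Hypothesis cardI : #|I| = d.+1.
Variable s : seq I.
Hypothesis s_perm : perm_eq s (enum I).

Let F1 : 1.-tuple {set I} := [tuple [set: I]%SET].
Let o1 (W : {set I}) := if W == [set: I]%SET then s else enum W.
Let o1P := o1_perm s_perm.
Let part1 (j : 'I_1) (i : I) : (part F1 i == j) = true.
Proof. by apply/eqP; rewrite [LHS]ord1 [RHS]ord1. Qed.
Let fl : is_flag F1.
Proof. have [x0 _] := simplex_cons cardI s_perm; exact: is_flag_single x0. Qed.

Lemma simplex_frame_sum (c : 'I_d) : \sum_i frame R [:: s] c i = 0.
Proof.
have := @frame_tangent R I 0 d cardI o1 F1 o1P fl c ord0.
by rewrite o1_map => H; rewrite -[RHS]H; apply: eq_bigl => i; rewrite part1.
Qed.

Lemma simplex_normr_det (e : 'I_(1 + d) -> I) (w : I -> R) : bijective e ->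
  \sum_i w i = 1 ->
  `|\det (block_rows e (fun=> ord0 : 'I_1) w (fun c => frame R [:: s] (c : 'I_d)))| = 1.
Proof.
move=> be w1; have := @normr_det_frame R I 0 d cardI o1 F1 o1P fl e w be.
rewrite o1_map part_single; apply => j.
by rewrite -[RHS]w1; apply: eq_bigl => i; rewrite [j]ord1.
Qed.

(** Here the columns follow the same ordering as the frame, so the sign is known. *)
Lemma simplex_det_order (x0 : I) (w : I -> R) : \sum_i w i = 1 ->
  \det (block_rows (nth_order s x0 : 'I_(1 + d) -> I) (fun=> ord0 : 'I_1) w
     (fun c => frame R [:: s] (c : 'I_d))) = 1.
Proof.
move=> w1; have be := nth_order_bij cardI s_perm x0.
rewrite (det_block_rows_normal
  (theta' := fun i => (i == flag_head o1 F1 x0 ord0)%:R) be); first last.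
- by move=> c j; rewrite -[RHS](simplex_frame_sum c); apply: eq_bigl => i; rewrite [j]ord1.
- move=> j; rewrite (bigD1 (flag_head o1 F1 x0 ord0)) ?[j]ord1//= eqxx big1 ?addr0//.
  by move=> i /negbTE ->.
- by move=> j; rewrite -[RHS]w1; apply: eq_bigl => i; rewrite [j]ord1.
rewrite (_ : (fun c : 'I_d => _) =
    fun c i => (i == flag_tnth o1 F1 x0 c)%:R - (i == flag_head o1 F1 x0 ord0)%:R); last first.
  apply/funext => c; rewrite -(o1_map s) -/o1 -/F1 (@flag_frameE I 0 d cardI o1 F1 o1P fl x0 R).
  by rewrite part_single.
rewrite (@block_rows_frame _ _ 0 d (fun=> ord0) (flag_head o1 F1 x0) (flag_tnth o1 F1 x0));
  last by move=> j; rewrite [RHS]ord1.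
rewrite (_ : \matrix_(_, _) _ = 1%:M) ?det1//.
have [y [s' sE]] := simplex_cons cardI s_perm.
apply/matrixP => a b; rewrite !mxE.
suff -> : vertex_of (flag_head o1 F1 x0) (flag_tnth o1 F1 x0) a = nth_order s x0 a.
  by rewrite (inj_eq (bij_inj be)).
have [c ->|->] := unliftP ord0 a.
  rewrite /vertex_of split_lift1 /flag_tnth /flag_tail o1_map /nth_order.
  by rewrite sE /= cats0.
rewrite /vertex_of split_ord0 /flag_head /nth_order (tnth_nth finset.set0) /= /o1 eqxx.
by rewrite sE.
Qed.

Lemma integral_volume_form :
  integral_form [:: s] (simplices [:: [set: I]%SET]) (@volume_form R I s d) =
  Num.sqrt d.+1%:R / d`!%:R.
Proof.
have [x0 _] := simplex_cons cardI s_perm.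
rewrite /integral_form (chart_simplex cardI s_perm).
set A := [set u | _].
have mA : measurable A by exact: (measurable_chart_region _ true).
have muA : lebesgue_tuple R d A = (d`!%:R^-1)%:E.
  exact: (lebesgue_simplex_chart cardI s_perm R true).
rewrite (_ : (fun u => _) = cst (Num.sqrt d.+1%:R)).
  by rewrite Rintegral_cst//; congr (_ * _); rewrite -[RHS]/(fine _%:E) -muA.
apply/funext => u; pose w := fun i : I => (d.+1%:R : R)^-1.
have w1 : \sum_i w i = 1.
  by rewrite sumr_const cardI -[_^-1 *+ _]mulr_natl mulfV// pnatr_eq0.
rewrite (volume_form_det cardI s_perm x0 _ w1); last exact: simplex_frame_sum.
by rewrite simplex_det_order// mulr1.
Qed.

End simplex_frame.

Lemma measurable_det (R : realType) d (T : measurableType d) (n : nat)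
    (M : T -> 'M[R]_n) (D : set T) :
  (forall i j, measurable_fun D (fun u => M u i j)) ->
  measurable_fun D (fun u => \det (M u)).
Proof.
move=> mM; rewrite /determinant.
apply: measurable_sum => s; apply: measurable_funM => //.
exact: measurable_prod.
Qed.

Lemma prodnb (R : realType) (I : finType) (P : pred I) (b : I -> bool) :
  \prod_(i | P i) (b i)%:R = [forall (i | P i), b i]%:R :> R.
Proof.
have [/forall_inP H|/forall_inPn[i Pi /negbTE bi]] := boolP [forall (i | P i), b i].
  by rewrite big1// => i /H ->.
by rewrite (bigD1 i)//= bi mul0r.
Qed.

(** * The value of the blow-up Whitney form *)

Section whitney.
Variables (R : realType) (V : finType) (m k : nat).
Hypothesis cardV : #|V| = (m + k).+1.
Variables (o : {set V} -> seq V) (F : m.+1.-tuple {set V}).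
Hypothesis o_perm : forall W, perm_eq (o W) (enum W).
Hypothesis flagF : is_flag F.
Variables (sR : seq 'I_m.+1) (x0 : V).
Hypothesis sR_perm : perm_eq sR (enum 'I_m.+1).

Let s := o [set: V]%SET.
Lemma order_setT_perm : perm_eq s (enum V).
Proof. by have := o_perm [set: V]%SET; rewrite enum_setT /enum_mem filter_predT. Qed.
Definition col_order : 'I_(m.+1 + k) -> V := nth_order s x0.

Definition open_chart_R : set (m.-tuple (measurableTypeR R)) :=
  [set u | forall j, 0 < chart [:: sR] u j].

Definition frame_det_R (r : 'I_m.+1 -> R) : R :=
  \det (block_rows (id : 'I_(1 + m) -> 'I_m.+1) (fun=> ord0 : 'I_1) r
     (fun a => frame R [:: sR] (a : 'I_m))).

Lemma frame_det_R_indep r r' : \sum_j r j = 1 -> \sum_j r' j = 1 ->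
  frame_det_R r = frame_det_R r'.
Proof.
move=> r1 r'1; apply: det_block_rows_normal.
- by exists id.
- by move=> j; rewrite -[RHS]r1; apply: eq_bigl => i; rewrite [j]ord1.
- by move=> j; rewrite -[RHS]r'1; apply: eq_bigl => i; rewrite [j]ord1.
- move=> c j; rewrite -[RHS](simplex_frame_sum R (card_ord _) sR_perm c).
  by apply: eq_bigl => i; rewrite [j]ord1.
Qed.

Definition moment_density (u : m.-tuple (measurableTypeR R)) : R :=
  \prod_j chart [:: sR] u j ^+ #|tnth F j|.-1.

(** The indicator of R_rho on the interior of R, as a product over consecutive indices. *)
Definition chain_indicator (rho : 'I_m.+1 -> R) (u : m.-tuple (measurableTypeR R)) : R :=
  \prod_(p : 'I_m.+1 * 'I_m.+1 | p.2 == p.1.+1 :> nat)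
    (chart [:: sR] u p.1 / rho p.1 <= chart [:: sR] u p.2 / rho p.2)%R%:R.

Definition chain_moment rho : R :=
  \int[lebesgue_tuple R m]_(u in open_chart_R) (chain_indicator rho u * moment_density u).

Lemma measurable_open_chart_R : measurable open_chart_R.
Proof. exact: (measurable_chart_region _ false). Qed.

Lemma measurable_chain_indicator rho D : measurable_fun D (chain_indicator rho).
Proof.
apply: measurable_funTS.
rewrite (_ : chain_indicator rho = fun u =>
    \prod_(p <- [seq p : 'I_m.+1 * 'I_m.+1 <- index_enum _ | p.2 == p.1.+1 :> nat])
      (chart [:: sR] u p.1 / rho p.1 <= chart [:: sR] u p.2 / rho p.2)%R%:R); last first.
  by apply/funext => u; rewrite big_filter.
apply: measurable_prod => p _.
have mR : measurable_fun [set: bool] (fun x : bool => x%:R : R) by [].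
apply: (measurableT_comp mR); apply: measurable_fun_ler;
  by apply: measurable_funM => //; exact: measurable_chart.
Qed.

Lemma measurable_moment_density D : measurable_fun D moment_density.
Proof.
apply: measurable_funTS; apply: measurable_prod => j _.
by apply: measurable_funX; exact: measurable_chart.
Qed.

Lemma moment_density_bound u : open_chart_R u -> 0 <= moment_density u <= 1.
Proof.
move=> u0; have ch j : 0 <= chart [:: sR] u j <= 1.
  rewrite ltW ?u0//= -(sum_simplex_chart (card_ord _) sR_perm u) (bigD1 j)//= lerDl.
  by apply: sumr_ge0 => i _; rewrite ltW.
apply/andP; split; first by apply: prodr_ge0 => j _; rewrite exprn_ge0//; case/andP: (ch j).
by apply: prodr_ile1 => j _; have /andP[c0 c1] := ch j; rewrite exprn_ge0//= exprn_ile1.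
Qed.

Lemma chain_indicator_bound rho u : 0 <= chain_indicator rho u <= 1.
Proof. by rewrite /chain_indicator prodnb; case: [forall (_ | _), _]; rewrite lexx ler01. Qed.

Lemma lebesgue_open_chart_R : lebesgue_tuple R m open_chart_R = (m`!%:R^-1)%:E.
Proof. exact: (lebesgue_simplex_chart (card_ord _) sR_perm R false). Qed.

Lemma integrable_open_chart_R (f : m.-tuple (measurableTypeR R) -> R) :
  measurable_fun open_chart_R f -> (forall u, open_chart_R u -> `|f u| <= 1) ->
  (lebesgue_tuple R m).-integrable open_chart_R (EFin \o f).
Proof.
move=> mf bf; apply: measurable_bounded_integrable => //.
- exact: measurable_open_chart_R.
- by have := ltry (m`!%:R^-1 : R); rewrite -lebesgue_open_chart_R.
- by exists 1; split => // M M1 u /bf /le_trans; apply; exact: ltW.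
Qed.

Lemma integral_moment_density :
  \int[lebesgue_tuple R m]_(u in open_chart_R) moment_density u =
  (\prod_j (#|tnth F j|.-1)`!%:R) / (m + k)`!%:R.
Proof.
rewrite /Rintegral (simplex_moment (card_ord _) sR_perm R (fun j => #|tnth F j|.-1)) /=.
congr (_ / _`!%:R).
have : (\sum_j #|tnth F j| = \sum_j #|tnth F j|.-1 + m.+1)%N.
  rewrite -[X in (_ + X)%N](_ : (\sum_(j < m.+1) 1 = m.+1)%N); last by rewrite sum1_card card_ord.
  rewrite -big_split; apply: eq_bigr => j _ /=.
  by rewrite addn1 prednK// card_flag_gt0.
by rewrite (sum_card_flag cardV flagF) addnS => -[].
Qed.

End whitney.

Section whitney_value.
Variables (R : realType) (V : finType) (m k : nat).
Hypothesis cardV : #|V| = (m + k).+1.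
Variables (o : {set V} -> seq V) (F : m.+1.-tuple {set V}).
Hypothesis o_perm : forall W, perm_eq (o W) (enum W).
Hypothesis flagF : is_flag F.
Variables (sR : seq 'I_m.+1) (x0 : V).
Hypothesis sR_perm : perm_eq sR (enum 'I_m.+1).
Let e : 'I_(m.+1 + k) -> V := col_order o x0.
Let sP := order_setT_perm o_perm.

(** The monomial is extracted from the determinant for nonzero r only; the boundary of R
    is negligible because the closed and the open simplex have the same volume. *)
Lemma closed_open_chart_R_null :
  lebesgue_tuple R m ([set u | forall j, 0 <= chart [:: sR] u j] `\` open_chart_R sR) = 0%E.
Proof.
have c1 := lebesgue_simplex_chart (card_ord m.+1) sR_perm R true.
have c0 := lebesgue_simplex_chart (card_ord m.+1) sR_perm R false.
have mC := @measurable_chart_region R _ [:: sR] m true.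
have mO := @measurable_chart_region R _ [:: sR] m false.
set mu := (X in X _ = _); rewrite [LHS](measureD mC mO); last first.
  by have := ltry (m`!%:R^-1 : R); rewrite -c1.
rewrite (_ : _ `&` _ = open_chart_R sR).
  by rewrite [X in (X - _)%E]c1 [X in (_ - X)%E]c0 subee.
by apply/seteqP; split => u /=; [case|move=> u0; split => // j; rewrite ltW ?u0].
Qed.

(** The pullback formula has a factor depending on r alone and a factor depending on
    (theta, Y) alone. The point r0 only serves to evaluate the constant volume form
    of R on its frame. *)
Lemma whitney_atE (rho r0 : 'I_m.+1 -> R) (theta : V -> R) (Y : 'I_k -> V -> R) :
  \sum_j r0 j = 1 ->
  (forall j, \sum_(i | part F i == j) theta i = 1) ->
  (forall c j, \sum_(i | part F i == j) Y c i = 0) ->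
  whitney_at o F sR rho theta Y =
  chain_moment F sR rho *
    ((m + k)`!%:R * frame_det_R sR r0 * \det (block_rows e (part F) theta Y)).
Proof.
move=> r01 th Y0; rewrite /whitney_at /fiber_integral.
pose K := (m + k)`!%:R * frame_det_R sR r0.
pose D (u : m.-tuple (measurableTypeR R)) :=
  \det (block_rows e (part F) theta (fun c i => chart [:: sR] u (part F i) * Y c i)).
have alphaE u : pullback (Phi F) (@unit_volume_form R V (o [set: V]%SET) (m + k))
    (chart [:: sR] u, theta) (prod_vectors (fun a : 'I_m => frame R [:: sR] a) Y) = K * D u.
  rewrite /pullback /unit_volume_form.
  rewrite (integral_volume_form R cardV sP).
  have := pullback_volume cardV x0 sP (r := chart [:: sR] u) flagF
    (sum_simplex_chart (card_ord m.+1) sR_perm u) th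
    (simplex_frame_sum R (card_ord m.+1) sR_perm) Y0.
  rewrite /pullback => ->.
  rewrite -/(frame_det_R sR (chart [:: sR] u)).
  rewrite (frame_det_R_indep sR_perm (sum_simplex_chart (card_ord m.+1) sR_perm u) r01).
  rewrite invf_div !mulrA; congr (_ * _ * _); rewrite mulfVK//.
set Cl := [set u : m.-tuple (measurableTypeR R) | forall j, 0 <= chart [:: sR] u j].
pose P := chain_indicator sR rho @^-1` [set 1].
have mCl : measurable Cl by exact: (measurable_chart_region _ true).
have mOp := @measurable_open_chart_R R m sR.
have mP : measurable P.
  by rewrite -[P]setTI; apply: (measurable_chain_indicator sR rho) => //; exact: measurable_set1.
have PE u : P u <-> forall i j : 'I_m.+1, j = i.+1 :> nat ->
    chart [:: sR] u i / rho i <= chart [:: sR] u j / rho j.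
  rewrite /P /= /chain_indicator prodnb; split.
    case: forall_inP => [H _ i j ij|_ /eqP]; last by rewrite eq_sym oner_eq0.
    by apply: (H (i, j)); rewrite /= ij.
  move=> H; rewrite (_ : [forall (_ | _), _] = true)//.
  by apply/forall_inP => -[i j] /= /eqP; exact: H.
rewrite (_ : _ @^-1` _ = Cl `&` P); last first.
  apply/seteqP; split => u.
    move=> [/= rs rc]; split; last exact/PE.
    by have : (@chart R _ [:: sR] m @^-1` simplices [:: [set: 'I_m.+1]%SET]) u by [];
       rewrite (chart_simplex (card_ord m.+1) sR_perm).
  move=> [uC /PE uP]; split => //.
  by have : Cl u by []; rewrite /Cl -(chart_simplex (card_ord m.+1) sR_perm).
rewrite (_ : (fun u => _) = (fun u => K * D u)); last exact/funext.
have mD A : measurable_fun A D.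
  apply: measurable_funTS; apply: measurable_det => a b.
  rewrite (_ : (fun _ => _) = fun u => match fintype.split a with
     | inl j => (part F (e b) == j)%:R * theta (e b)
     | inr c => chart [:: sR] u (part F (e b)) * Y c (e b) end).
    case: (fintype.split a) => j //.
    by apply: measurable_funM => //; exact: measurable_chart.
  by apply/funext => u; rewrite mxE; case: (fintype.split a) => c; rewrite mxE.
rewrite -[in RHS]/K /chain_moment -RintegralZr//; last first.
  apply: (integrable_open_chart_R sR_perm).
    apply: measurable_funM; first exact: measurable_chain_indicator.
    exact: measurable_moment_density.
  move=> u /(moment_density_bound F sR_perm) /andP[d0 d1].
  have /andP[i0 i1] := chain_indicator_bound sR rho u.
  by rewrite ger0_norm ?mulr_ge0// mulr_ile1.
congr fine; rewrite integral_mkcondr.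
pose g := (fun u => (K * D u)%:E) \_ P.
have mg A : measurable A -> measurable_fun A g.
  move=> mA; apply: measurable_funTS; apply/(measurable_restrictT _ _).1 => //.
  by apply: measurable_funTS; apply/measurable_EFinP; apply: measurable_funM.
(* discard the boundary of R *)
transitivity (\int[lebesgue_tuple R m]_(u in Cl) (g \_ (open_chart_R sR)) u)%E.
  apply: ae_eq_integral => //.
  - exact: mg.
  - apply: measurable_funTS; apply/(measurable_restrictT _ _).1 => //.
    exact: mg.
  - exists (Cl `\` open_chart_R sR); split.
    + exact: measurableD.
    + exact: closed_open_chart_R_null.
    + move=> u /= /not_implyP[uC ne]; split => // uO; apply: ne.
      by rewrite [RHS]patchE mem_set.
rewrite -integral_mkcondr (_ : Cl `&` _ = open_chart_R sR); last first.
  by apply/seteqP; split => u /=; [case|move=> u0; split => // j; rewrite ltW ?u0].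
apply: eq_integral => u; rewrite inE => uO.
rewrite /g patchE; have r0' j : chart [:: sR] u j != 0 by rewrite gt_eqF ?uO.
have -> : D u = moment_density F sR u * \det (block_rows e (part F) theta Y).
  exact: (det_part_scale cardV x0 sP).
case: ifPn => [/set_mem|/negP uP].
  by rewrite /P /= => ->; congr (_%:E); rewrite /K; ring.
rewrite (_ : chain_indicator sR rho u = 0) ?mul0r//.
move: uP; rewrite inE /P /= /chain_indicator prodnb.
by case: [forall (_ | _), _].
Qed.

End whitney_value.

(** * The trace of the blow-up Whitney form on a fibre *)

Lemma derive1_affine_quotient (R : realType) (a b c d : R) : c != 0 ->
  derive1 (fun t : R => (a + t * b) / (c + t * d)) 0 = (b - a / c * d) / c.
Proof.
move=> c0.
have D : is_derive (0 : R) (1 : R) (fun t : R => (a + t * b) / (c + t * d))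
   ((b - a / c * d) / c).
  have c0' : c + 0 * d != 0 by rewrite mul0r addr0.
  apply: is_derive_eq; rewrite !mul0r !addr0 !scaler0 !add0r /GRing.scale /=.
  by field.
by rewrite derive1E; apply: derive_val.
Qed.

(** Written as (X - C x) / rho to match [det_block_rows_reduce] followed by
    [det_block_rows_scale]. *)
Lemma tdiff_theta_coord (R : realType) (V : finType) (m : nat)
    (F : m.+1.-tuple {set V}) (x X : V -> R) : (forall j, rho_coord F x j != 0) ->
  tdiff (theta_coord F) x X = fun i =>
    (rho_coord F x (part F i))^-1 *
    (X i - rho_coord F X (part F i) / rho_coord F x (part F i) * x i).
Proof.
move=> r0; apply/funext => i; rewrite /tdiff.
rewrite (_ : (fun t => _) = fun t : R => (x i + t * X i) /
    (rho_coord F x (part F i) + t * rho_coord F X (part F i))).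
  rewrite derive1_affine_quotient//; have := r0 (part F i).
  by move: (rho_coord F x _) (rho_coord F X _) => p q p0; field.
apply/funext => t; rewrite /theta_coord; congr (_ / _).
by rewrite /rho_coord mulr_sumr -big_split.
Qed.

Lemma tdiff_Phi_theta (R : realType) (V : finType) (m : nat)
    (F : m.+1.-tuple {set V}) (rho : 'I_m.+1 -> R) (theta Y : V -> R) :
  tdiff (fun theta => Phi F (rho, theta)) theta Y = fun i => rho (part F i) * Y i.
Proof.
apply/funext => i; rewrite /tdiff /Phi /=.
have D : is_derive (0 : R) (1 : R) (fun t : R => rho (part F i) * (theta i + t * Y i))
    (rho (part F i) * Y i).
  apply: is_derive_eq; rewrite ?mul0r ?addr0 ?scaler0 ?add0r /GRing.scale /=.
  ring.
by rewrite derive1E; apply: derive_val.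
Qed.

Section trace_value.
Variables (R : realType) (V : finType) (m k : nat).
Hypothesis cardV : #|V| = (m + k).+1.
Variables (o : {set V} -> seq V) (F F' : m.+1.-tuple {set V}).
Hypothesis o_perm : forall W, perm_eq (o W) (enum W).
Hypotheses (flagF : is_flag F) (flagF' : is_flag F').
Variables (sR : seq 'I_m.+1) (x0 : V).
Hypothesis sR_perm : perm_eq sR (enum 'I_m.+1).
Let e : 'I_(m.+1 + k) -> V := col_order o x0.

(** The columns of the matrix are first divided by the F-coordinates rhoF; the tangent
    rows are reduced; then the columns are multiplied by the F'-coordinates rho. *)
Lemma trace_whitneyE (rho r0 : 'I_m.+1 -> R) (theta : V -> R) (Y : 'I_k -> V -> R) :
  \sum_j r0 j = 1 -> (forall j, 0 < rho j) -> (forall i, 0 < theta i) ->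
  let rhoF := rho_coord F (Phi F' (rho, theta)) in
  trace F' (@whitney R V m k o F sR) rho theta Y =
  chain_moment F sR rhoF * (\prod_i (rho (part F' i) / rhoF (part F i))) *
    ((m + k)`!%:R * frame_det_R sR r0 * \det (block_rows e (part F) theta Y)).
Proof.
move=> r01 rho0 th0 rhoF; rewrite /trace /pullback /whitney.
set x := Phi F' (rho, theta); rewrite -/x in rhoF *.
have x_gt0 i : 0 < x i by rewrite /x /Phi /= mulr_gt0.
have rhoF0 j : 0 < rhoF j.
  rewrite /rhoF /rho_coord; have [i /eqP] := part_surj flagF j.
  rewrite part_flag// => ij; rewrite (bigD1 i)//= ltr_pwDl//.
  by apply: sumr_ge0 => i' _; rewrite ltW.
have rhoFn j : rhoF j != 0 by rewrite gt_eqF.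
have be : bijective e by exact: (nth_order_bij cardV (order_setT_perm o_perm)).
rewrite (whitney_atE cardV o_perm flagF x0 sR_perm rhoF r01); last 2 first.
- move=> j; rewrite -sum_flag_part//.
  rewrite /theta_coord; under eq_bigr => i ij.
    rewrite -part_flag// in ij; rewrite (eqP ij); over.
  by rewrite -mulr_suml mulfV// rhoFn.
- move=> c j; under eq_bigr => i /eqP ij do rewrite tdiff_theta_coord// ij.
  rewrite -mulr_sumr sumrB -mulr_sumr -!sum_flag_part//.
  by rewrite -/(rho_coord F x j) mulfVK ?rhoFn// subrr mulr0.
rewrite -!mulrA; congr (_ * _); rewrite -/e.
rewrite [RHS]mulrCA; congr (_ * _).
rewrite [RHS]mulrCA; congr (_ * _).
rewrite (_ : theta_coord F x = fun i => (rhoF (part F i))^-1 * x i); last first.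
  by apply/funext => i; rewrite /theta_coord mulrC.
rewrite (_ : (fun a => _) = fun c i => (rhoF (part F i))^-1 *
  (rho (part F' i) * Y c i -
   rho_coord F (fun i => rho (part F' i) * Y c i) (part F i) / rhoF (part F i) * x i)); last first.
  by apply/funext => c; rewrite tdiff_theta_coord// tdiff_Phi_theta.
rewrite (det_block_rows_scale _ (fun i => (rhoF (part F i))^-1) _ _ be).
rewrite (det_block_rows_reduce e (part F) x (fun c j => rho_coord F (fun i => rho (part F' i) * Y c i) j / rhoF j)).
rewrite (_ : x = fun i => rho (part F' i) * theta i)//.
rewrite (det_block_rows_scale _ (fun i => rho (part F' i)) _ _ be) mulrA.
by congr (_ * _); rewrite -big_split; apply: eq_bigr => i _; rewrite mulrC.
Qed.

End trace_value.

(** * The iterated limit of the trace *)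

Lemma lexratio_self (R : realType) (s : seq R) (i : nat) : s`_i != 0 -> lexratio s s = 1.
Proof.
elim: s i => [|x s IH] i /=; first by rewrite nth_nil eqxx.
case: ifPn => [/eqP x0|x0 _]; last by rewrite divff.
by case: i => [|i] /=; [rewrite x0 eqxx|exact: IH].
Qed.

Lemma rho_of_seq_gt0 (R : realType) (m : nat) (s : seq R) (a : 'I_m.+1) :
  seq_dom m 1 s -> 0 < rho_of_seq s a.
Proof.
move=> [sm s0 s1]; rewrite /rho_of_seq; have [l ->|->] := unliftP ord0 a => /=.
  apply: s0; rewrite (_ : nth _ _ _ = s`_l) ?mem_nth ?sm//.
by rewrite subr_gt0.
Qed.

(** A strictly increasing self-map of an interval of integers satisfies i <= f i, and the
    sums agree. *)
Lemma increasing_perm_id (m : nat) (f : 'I_m.+1 -> 'I_m.+1) : injective f ->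
  (forall i j : 'I_m.+1, j = i.+1 :> nat -> (f i <= f j)%N) -> f =1 id.
Proof.
move=> fi fm.
have lef (i : 'I_m.+1) : (i <= f i)%N.
  case: i => i; elim: i => [|i IH] lt //=.
  have lt' : (i < m.+1)%N by exact: ltnW.
  apply: (leq_ltn_trans (IH lt')); rewrite ltn_neqAle fm//= andbT.
  by apply/eqP => /val_inj/fi/(congr1 val)/= /eqP; rewrite ltn_eqF.
have E : (\sum_(i < m.+1) i = \sum_(i < m.+1) f i)%N.
  by rewrite (reindex_inj fi).
move=> i; apply: val_inj => /=; apply/esym/eqP.
have [_] := leqif_sum (fun (i : 'I_m.+1) (_ : true) => leqif_eq (lef i)).
by rewrite E eqxx => /esym/forall_inP/(_ i isT).
Qed.

Section limits.
Variables (R : realType) (V : finType) (m k : nat).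
Hypothesis cardV : #|V| = (m + k).+1.
Variables (o : {set V} -> seq V) (F F' : m.+1.-tuple {set V}).
Hypothesis o_perm : forall W, perm_eq (o W) (enum W).
Hypotheses (flagF : is_flag F) (flagF' : is_flag F').
Variables (sR : seq 'I_m.+1) (x0 : V).
Hypothesis sR_perm : perm_eq sR (enum 'I_m.+1).
Let e : 'I_(m.+1 + k) -> V := col_order o x0.
Variables (theta : V -> R).
Hypothesis theta_gt0 : forall i, 0 < theta i.

(** The coefficients of the linear forms rho_j in rho'. *)
Definition overlap (j a : 'I_m.+1) : R :=
  \sum_(i | (part F i == j) && (part F' i == a)) theta i.

Lemma rho_coord_Phi (rho : 'I_m.+1 -> R) j :
  rho_coord F (Phi F' (rho, theta)) j = \sum_a overlap j a * rho a.
Proof.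
rewrite /rho_coord sum_flag_part// (partition_big (part F') xpredT)//=.
apply: eq_bigr => a _; rewrite mulr_suml; apply: eq_bigr => i /andP[_ /eqP ia].
by rewrite /Phi /= ia mulrC.
Qed.

Lemma overlap_ge0 j a : 0 <= overlap j a.
Proof. by apply: sumr_ge0 => i _; rewrite ltW. Qed.

Lemma overlap_gt0 i : 0 < overlap (part F i) (part F' i).
Proof.
rewrite /overlap (bigD1 i) ?eqxx//= ltr_pwDl//.
by apply: sumr_ge0 => i' _; rewrite ltW.
Qed.

(** The numerator rho'_a is rescaled by the overlap so that it is dominated by the
    denominator coefficient by coefficient. *)
Definition ratio_limit (i : V) : R :=
  (overlap (part F i) (part F' i))^-1 *
  lexratio (rho_coefs (fun b => overlap (part F i) b * (b == part F' i)%:R))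
    (rho_coefs (overlap (part F i))).

(** The inequality r_i / rho_i <= r_j / rho_j reads r_i rho_j - r_j rho_i <= 0, a linear
    condition on rho'. *)
Definition chain_limit (u : m.-tuple (measurableTypeR R)) : R :=
  \prod_(p : 'I_m.+1 * 'I_m.+1 | p.2 == p.1.+1 :> nat)
    (lexneg (rho_coefs (fun a => chart [:: sR] u p.1 * overlap p.2 a
                                 - chart [:: sR] u p.2 * overlap p.1 a)))%:R.

Let rhoF s := rho_coord F (Phi F' (rho_of_seq s, theta)).

Lemma rhoF_gt0 s j : seq_dom m 1 s -> 0 < rhoF s j.
Proof.
move=> sd; rewrite /rhoF rho_coord_Phi; have [i <-] := part_surj flagF j.
rewrite (bigD1 (part F' i))//= ltr_pwDl ?mulr_gt0 ?overlap_gt0 ?rho_of_seq_gt0//.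
by apply: sumr_ge0 => a _; rewrite mulr_ge0 ?overlap_ge0// ltW// rho_of_seq_gt0.
Qed.

Lemma iterlim_to_ratios :
  iterlim_to m 1 (fun s => \prod_i (rho_of_seq s (part F' i) / rhoF s (part F i)))
    (\prod_i ratio_limit i).
Proof.
apply: iterlim_to_prod => i _; set j := part F i; set a := part F' i.
have M0 := overlap_gt0 i; rewrite -/j -/a in M0.
have H : iterlim_to m 1 (fun s => (overlap j a)^-1 *
   ((\sum_b overlap j b * (b == a)%:R * rho_of_seq s b) / (\sum_b overlap j b * rho_of_seq s b)))
   (ratio_limit i).
  apply: iterlim_toM; first exact: iterlim_to_cst.
  apply: iterlim_to_ratio => b; rewrite mulr_ge0 ?overlap_ge0//=.
  by case: eqP; rewrite ?mulr1// mulr0 overlap_ge0.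
apply: eq_iterlim_to H => // s sd.
rewrite /rhoF rho_coord_Phi (bigD1 a)//= eqxx mulr1 big1 ?addr0; last first.
  by move=> b /negbTE ->; rewrite mulr0 mul0r.
by rewrite !mulrA mulVf ?mul1r// gt_eqF.
Qed.

Lemma iterlim_to_chain_moment :
  iterlim_to m 1 (fun s => chain_moment F sR (rhoF s))
    (\int[lebesgue_tuple R m]_(u in open_chart_R sR) (chain_limit u * moment_density F sR u)).
Proof.
have mO := @measurable_open_chart_R R m sR.
pose f s u := chain_indicator sR (rhoF s) u * moment_density F sR u.
have ih : (lebesgue_tuple R m).-integrable (open_chart_R sR) (EFin \o cst 1).
  by apply: (integrable_open_chart_R sR_perm) => // u _; rewrite /= normr1.
have mf s : seq_dom m 1 s -> measurable_fun (open_chart_R sR) (f s).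
  move=> _; apply: measurable_funM; first exact: measurable_chain_indicator.
  exact: measurable_moment_density.
have bf s u : seq_dom m 1 s -> open_chart_R sR u -> `|f s u| <= cst 1 u.
  move=> _ /(moment_density_bound F sR_perm) /andP[d0 d1].
  have /andP[i0 i1] := chain_indicator_bound sR (rhoF s) u.
  by rewrite ger0_norm ?mulr_ge0// mulr_ile1.
have fl u : open_chart_R sR u ->
    iterlim_to m 1 (f ^~ u) (chain_limit u * moment_density F sR u).
  move=> uO; apply: iterlim_toM; last exact: iterlim_to_cst.
  have H : iterlim_to m 1 (fun s => \prod_(p : 'I_m.+1 * 'I_m.+1 | p.2 == p.1.+1 :> nat)
      (\sum_a (chart [:: sR] u p.1 * overlap p.2 a - chart [:: sR] u p.2 * overlap p.1 a)
         * rho_of_seq s a <= 0)%R%:R) (chain_limit u).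
    by apply: iterlim_to_prod => p _; exact: iterlim_to_le0.
  apply: eq_iterlim_to H => // s sd.
  apply: eq_bigr => -[i j] _ /=; congr (nat_of_bool _)%:R.
  rewrite ler_pdivrMr ?rhoF_gt0// mulrAC ler_pdivlMr ?rhoF_gt0//.
  rewrite -[RHS]subr_le0 /rhoF !rho_coord_Phi !mulr_sumr -sumrB; congr (_ <= _).
  by apply: eq_bigr => a _; rewrite mulrBl !mulrA.
by have [] := iterlim_to_integral mO ih ltr01 mf bf fl.
Qed.

Lemma iterlim_to_trace (r0 : 'I_m.+1 -> R) (Y : 'I_k -> V -> R) : \sum_j r0 j = 1 ->
  iterlim_to m 1 (fun s => trace F' (@whitney R V m k o F sR) (rho_of_seq s) theta Y)
   (\int[lebesgue_tuple R m]_(u in open_chart_R sR) (chain_limit u * moment_density F sR u)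
    * (\prod_i ratio_limit i)
    * ((m + k)`!%:R * frame_det_R sR r0 * \det (block_rows e (part F) theta Y))).
Proof.
move=> r01.
have H := iterlim_toM (iterlim_toM iterlim_to_chain_moment iterlim_to_ratios)
  (iterlim_to_cst m 1 ((m + k)`!%:R * frame_det_R sR r0 * \det (block_rows e (part F) theta Y))).
apply: eq_iterlim_to H => // s sd.
rewrite (@trace_whitneyE R V m k cardV o F F' o_perm flagF sR x0 sR_perm (rho_of_seq s) r0 theta Y r01)//.
by move=> j; exact: rho_of_seq_gt0.
Qed.

(** If no quotient tends to 0, each part of F lies in one part of F'; the resulting map mu
    of indices is onto, hence bijective, and it is not the identity, so it reverses
    some consecutive pair i, j = i + 1. Then rho_i / rho_j tends to 0 and the condition
    r_i / rho_i <= r_j / rho_j fails for r_i > 0. *)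
Lemma limit_off_diagonal : F' != F ->
  \int[lebesgue_tuple R m]_(u in open_chart_R sR) (chain_limit u * moment_density F sR u)
    * (\prod_i ratio_limit i) = 0.
Proof.
move=> FF'.
have [/existsP[i /existsP[b /andP[bi Mb]]]|/existsPn H] :=
  boolP [exists i, [exists b : 'I_m.+1, (b < part F' i)%N && (overlap (part F i) b != 0)]].
  rewrite (bigD1 i)//= /ratio_limit (lexratio_rho_coefs (i := b)) ?mulr0 ?mul0r ?mulr0//.
  move=> a ab; case: eqP => [aE|_]; last by rewrite mulr0.
  by move: bi; rewrite -aE ltnNge ab.
(* each part of F now lies in a single part of F' *)
have le i i' : part F i = part F i' -> (part F' i <= part F' i')%N.
  move=> ii'; rewrite leqNgt; apply/negP => lt.
  have /existsPn/(_ (part F' i')) := H i; rewrite lt /= ii' negbK.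
  by rewrite gt_eqF// overlap_gt0.
have /choice[g gP] := part_surj flagF.
pose mu j := part F' (g j).
have muE i : part F' i = mu (part F i).
  by apply: val_inj; apply/eqP; rewrite eqn_leq !le ?gP.
have mu_inj : injective mu.
  have /choice[h hP] : forall j, exists j', mu j' = j.
    by move=> j; have [i <-] := part_surj flagF' j; exists (part F i); rewrite muE.
  have hi : injective h by exact: can_inj hP.
  by apply: (can_inj (g := h)); exact: (canF_sym hP).
have ov j a : overlap j a = (a == mu j)%:R * overlap j a.
  case: eqP => [_|ne]; rewrite ?mul1r// mul0r; apply: big_pred0 => i.
  apply/negbTE; apply/negP => /andP[/eqP ij /eqP ia].
  by apply: ne; rewrite -ia muE ij.
have [/existsP[[i j] /= /andP[/eqP ij lt]]|/existsPn H'] :=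
  boolP [exists p : 'I_m.+1 * 'I_m.+1, (p.2 == p.1.+1 :> nat) && (mu p.2 < mu p.1)%N].
  rewrite (_ : \int[_]_(_ in _) _ = 0) ?mul0r//.
  rewrite (@eq_Rintegral _ _ _ _ _ (cst 0)); first by rewrite Rintegral_cst ?mul0r//; exact: measurable_open_chart_R.
  move=> u; rewrite inE => uO.
  have ovj : 0 < overlap j (mu j) by have := overlap_gt0 (g j); rewrite gP.
  have c0 : 0 < chart [:: sR] u i * overlap j (mu j) - chart [:: sR] u j * overlap i (mu j).
    rewrite (ov i) (negbTE (_ : mu j != mu i)) ?mul0r ?mulr0 ?subr0 ?mulr_gt0 ?uO//.
    by rewrite -val_eqE /= ltn_eqF.
  have lx : lexneg (rho_coefs (fun a => chart [:: sR] u i * overlap j a -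
      chart [:: sR] u j * overlap i a)) = false.
    rewrite (lexneg_rho_coefs (i := mu j)) ?gt_eqF//; first exact: lt_gtF.
    move=> a aj; rewrite (ov j) (ov i).
    have -> : (a == mu j) = false by rewrite -val_eqE /= ltn_eqF.
    have -> : (a == mu i) = false by rewrite -val_eqE /= ltn_eqF// (ltn_trans aj).
    by rewrite !mul0r !mulr0 subrr.
  rewrite /chain_limit (bigD1 (i, j)); last exact/eqP.
  by rewrite [X in (nat_of_bool X)%:R * _ * _]lx !mul0r.
case/eqP: FF'; have mu1 : mu =1 id.
  apply: increasing_perm_id => // i j ij; rewrite leqNgt.
  by have := H' (i, j); rewrite /= ij eqxx.
apply: eq_from_tnth => j; apply/setP => i.
by rewrite -!part_flag// muE mu1.
Qed.

End limits.

(** Here rho_j = rho'_j, and rho_i / rho_j tends to infinity for j = i + 1, so the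
    inequalities r_i / rho_i <= r_j / rho_j all hold in the limit for r_j > 0. *)
Lemma limit_diagonal (R : realType) (V : finType) (m k : nat)
    (F : m.+1.-tuple {set V}) (sR : seq 'I_m.+1) (theta : V -> R) :
  #|V| = (m + k).+1 ->
  perm_eq sR (enum 'I_m.+1) -> is_flag F -> (forall i, 0 < theta i) ->
  (forall j, \sum_(i | part F i == j) theta i = 1) ->
  \int[lebesgue_tuple R m]_(u in open_chart_R sR)
      (chain_limit F F sR theta u * moment_density F sR u)
    * (\prod_i ratio_limit F F theta i) =
  (\prod_j (#|tnth F j|.-1)`!%:R) / (m + k)`!%:R.
Proof.
move=> cardV sR_perm flagF th0 th1.
have ov j a : overlap F F theta j a = (a == j)%:R.
  rewrite /overlap; case: eqP => [->|ne]; first by rewrite -[RHS](th1 j); apply: eq_bigl => i; rewrite andbb.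
  apply: big_pred0 => i; apply/negbTE; apply/negP => /andP[/eqP ij /eqP ia].
  by apply: ne; rewrite -ia -ij.
rewrite [X in _ * X]big1 ?mulr1 => [|i _]; last first.
  rewrite /ratio_limit ov eqxx invr1 mul1r.
  rewrite (_ : (fun b => _) = overlap F F theta (part F i)).
    apply: (lexratio_self (i := part F i)); rewrite nth_rho_coefs !ov eqxx.
    have [E|ne] := eqVneq (part F i) ord0; first by rewrite mul0r subr0 oner_eq0.
    by rewrite mulr0 subr0 oner_eq0.
  by apply/funext => b; rewrite ov; case: eqP; rewrite ?mulr1 ?mulr0.
rewrite -(integral_moment_density R cardV flagF sR_perm).
apply: eq_Rintegral => u; rewrite inE => uO; rewrite /chain_limit big1 ?mul1r//.
move=> [i j] /eqP ij; have ne : (i == j) = false by rewrite -val_eqE /= [X in _ == X]ij ltn_eqF.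
suff -> : lexneg (rho_coefs (fun a => chart [:: sR] u i * overlap F F theta j a -
      chart [:: sR] u j * overlap F F theta i a)) = true by [].
have ci : chart [:: sR] u i * overlap F F theta j i -
    chart [:: sR] u j * overlap F F theta i i < 0.
  by rewrite !ov ne eqxx mulr0 mulr1 sub0r oppr_lt0 uO.
rewrite (lexneg_rho_coefs (i := i)) ?lt_eqF// => a ai; rewrite !ov.
have -> : (a == i) = false by rewrite -val_eqE /= ltn_eqF.
have -> : (a == j) = false by rewrite -val_eqE /= [X in _ == X]ij ltn_eqF// ltnW.
by rewrite !mulr0 subrr.
Qed.

(** * Duality *)

Lemma open_R_uniform (R : realType) (m : nat) :
  @open_R R m (fun=> m.+1%:R^-1).
Proof.
split=> [i|W]; first by rewrite invr_gt0 ltr0n.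
rewrite mem_seq1 => /eqP ->.
by rewrite sumr_const cardsT card_ord -[_^-1 *+ _]mulr_natl mulfV// pnatr_eq0.
Qed.

Lemma open_simplices_part (R : realType) (V : finType) (m : nat)
    (F : m.+1.-tuple {set V}) (theta : V -> R) : is_flag F ->
  open_simplices F theta ->
  (forall i, 0 < theta i) /\ (forall j, \sum_(i | part F i == j) theta i = 1).
Proof.
move=> fF [t0 t1]; split => // j.
by rewrite -sum_flag_part// t1// mem_tnth.
Qed.

(** Both determinants are 1 up to sign; their product has the sign of the pullback of the
    volume form, which is positive by the orientation of R. *)
Lemma oriented_det1 (R : realType) (V : finType) (m k : nat)
    (o : {set V} -> seq V) (F : m.+1.-tuple {set V}) (sR : seq 'I_m.+1) (x0 : V)
    (r0 : 'I_m.+1 -> R) (theta : V -> R) :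
  #|V| = (m + k).+1 -> (forall W, perm_eq (o W) (enum W)) -> is_flag F ->
  R_oriented R k o F sR -> open_R r0 -> open_simplices F theta ->
  frame_det_R sR r0 *
  \det (block_rows (col_order o x0 : 'I_(m.+1 + k) -> V) (part F) theta
     (fun c => frame R (map o F) (c : 'I_k))) = 1.
Proof.
move=> cardV o_perm flagF [sR_perm orient] r0o tho.
have sP := order_setT_perm o_perm.
have be := nth_order_bij cardV sP x0.
have [r0_gt0 /(_ [set: 'I_m.+1]%SET)] := r0o.
rewrite mem_head => /(_ isT); under eq_bigl do rewrite inE; move=> r01.
have [th0 th1] := open_simplices_part flagF tho.
have ft (c : 'I_k) j := frame_tangent R cardV o_perm flagF c j.
set f := frame_det_R sR r0; set g := \det _.
have f1 : `|f| = 1.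
  by apply: (simplex_normr_det (card_ord _) sR_perm); [exists id|].
have g1 : `|g| = 1 by exact: (normr_det_frame cardV o_perm flagF).
suff fg : 0 < f * g by rewrite -(gtr0_norm fg) normrM f1 g1 mulr1.
have := orient r0 theta r0o tho.
rewrite (pullback_volume cardV x0 sP flagF r01 th1
  (simplex_frame_sum R (card_ord _) sR_perm) ft).
rewrite (det_part_scale cardV x0 sP theta (fun c => frame R (map o F) (c : 'I_k)) flagF);
  last by move=> j; rewrite gt_eqF.
rewrite -/(frame_det_R sR r0) -/f -[\det _]/g.
rewrite mulrCA pmulr_rgt0; last by apply: prodr_gt0 => j _; rewrite exprn_gt0.
by rewrite -mulrA pmulr_rgt0// sqrtr_gt0 ltr0n.
Qed.

Lemma dof_whitney (R : realType) (V : finType) (m k : nat)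
    (o : {set V} -> seq V) (F F' : m.+1.-tuple {set V}) (sR : seq 'I_m.+1) :
  #|V| = (m + k).+1 -> (forall W, perm_eq (o W) (enum W)) ->
  is_flag F -> is_flag F' -> R_oriented R k o F sR ->
  dof_defined o F' (@whitney R V m k o F sR) /\
  dof o F' (@whitney R V m k o F sR) = if F' == F then 1 else 0.
Proof.
move=> cardV o_perm flagF flagF' orient; have sR_perm := orient.1.
have [x0 _] : exists x0 : V, true by apply/card_gt0P; rewrite cardV.
have r0o := open_R_uniform R m.
set r0 := (fun=> _) in r0o.
have r01 : \sum_j r0 j = 1.
  have [_ /(_ [set: 'I_m.+1]%SET)] := r0o.
  by rewrite mem_head => /(_ isT); under eq_bigl do rewrite inE.
pose psi := @whitney R V m k o F sR.
have lims theta Y : open_simplices F' theta ->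
    iter_lim_exists m 1 (fun s => trace F' psi (rho_of_seq s) theta Y) /\
    trace_lim F' psi theta Y = if F' == F then
      (\prod_j (#|tnth F j|.-1)`!%:R) * (frame_det_R sR r0 *
        \det (block_rows (col_order o x0 : 'I_(m.+1 + k) -> V) (part F) theta Y)) else 0.
  move=> tho; have [th0 th1] := open_simplices_part flagF' tho.
  have L := @iterlim_to_trace R V m k cardV o F F' o_perm flagF sR x0 sR_perm theta th0 r0 Y r01.
  have [ex lE] := iterlim_toP ltr01 L; split; first exact: ex.
  rewrite /trace_lim lE; case: eqVneq => [FF'|FF'].
    rewrite FF' in th1 *.
    rewrite (limit_diagonal cardV sR_perm flagF th0 th1).
    by rewrite !mulrA mulfVK// pnatr_eq0 -lt0n fact_gt0.
  by rewrite (@limit_off_diagonal R V m F F' flagF flagF' sR theta th0 FF') mul0r.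
pose D := @chart R V (map o F') k @^-1` open_simplices F'.
have DE : D = [set u | forall i, 0 < chart (map o F') u i].
  exact: (chart_open_simplices cardV o_perm flagF').
have mD : measurable D by rewrite DE; exact: (measurable_chart_region _ false).
have muD : lebesgue_tuple R k D = (flag_vol F' R)%:E.
  by rewrite DE; exact: (lebesgue_flag_chart cardV o_perm flagF' R false).
pose c : R := if F' == F then \prod_j (#|tnth F j|.-1)`!%:R else 0.
have limE u : D u -> trace_lim F' psi (chart (map o F') u)
    (fun a => frame R (map o F') (a : 'I_k)) = c.
  move=> Du; have [_ ->] := lims _ (fun a => frame R (map o F') (a : 'I_k)) Du.
  have tho : open_simplices F' (chart (map o F') u) := Du.
  rewrite /c; case: eqVneq => // FF'; rewrite FF' in tho *.
  by rewrite (oriented_det1 x0 cardV o_perm flagF orient r0o tho) mulr1.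
split; last first.
  rewrite /dof /integral_form -/D.
  rewrite (@eq_Rintegral _ _ _ _ _ (cst c)); last by move=> u /set_mem /limE.
  rewrite Rintegral_cst// -[X in c * X]/(fine (lebesgue_tuple R k D)) muD /= /c.
  case: eqVneq => [->|_]; last by rewrite mul0r.
  rewrite /flag_vol -big_split big1//= => j _.
  by rewrite mulfV// pnatr_eq0 -lt0n fact_gt0.
split; first by move=> theta Y tho _; have [] := lims theta Y tho.
rewrite /integrable_form -/D.
apply: (@eq_integrable _ _ _ _ D mD (EFin \o cst c)).
  by move=> u /set_mem Du; congr EFin; rewrite limE.
apply: measurable_bounded_integrable => //.
- by have := ltry (flag_vol F' R); rewrite -muD.
- by exists `|c|; split=> [|M cM u _ /=]; [exact: num_real|exact: ltW].
Qed.

Theorem theorem2p27 (R : realType) (V : finType) (n k : nat)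
    (hV : #|V| = n.+1) (hk : (k <= n)%N)
    (o : {set V} -> seq V) (ho : forall W : {set V}, perm_eq (o W) (enum W))
    (F F' : (n - k).+1.-tuple {set V}) (hF : is_flag F) (hF' : is_flag F')
    (sR : seq 'I_(n - k).+1) (hsR : R_oriented R k o F sR) :
  dof_defined o F' (@whitney R V (n - k) k o F sR) /\
  dof o F' (@whitney R V (n - k) k o F sR) = if F' == F then 1 else 0.
Proof. by apply: dof_whitney => //; rewrite subnK. Qed.
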